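(* Let $A_1,\dots,A_k$ be matrices $A_i\in\mathbb{R}^{d\times r_i}$ with $\sum_{i=1}^k r_i=d$ such that $A=[A_1\cdots A_k]\in\mathbb{R}^{d\times d}$ satisfies $A^\top A=I_d$. For the decomposition $W=\sum_{i=1}^k A_iB_i$ of the parameter vector $W\in\mathbb{R}^d$ (with $B_i=A_i^\top W$), and the block-wise noisy fine-tuning algorithm (defined in the context) in which noisy fine-tuning is applied to the $i$-th block with privacy budget parameters $(\varepsilon_i,\delta)$, where $\varepsilon_i=\varepsilon_i^{\text{rényi}}+\frac{\log(1/\delta)}{q-1}$ and $\varepsilon_i^{\text{rényi}}$ is the Rényi privacy loss at order $q>1$ allotted to block $i$, there is an $(\varepsilon,\delta)$-unlearning guarantee (defined in the context), where $$\varepsilon=\sum_{i=1}^{k}\varepsilon_i^{\text{rényi}}+\frac{\log(1/\delta)}{q-1}.$$ The same statement holds in the unconditional clipping-based formulation, i.e. with an initial model clipping of radius $C_0$ in place of the discrepancy $\Delta(\rho)$ (with $C_0$ in place of $\Delta(\rho)/2$).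
   Context: Setting. $\mathcal{A}$ is a (possibly randomized) learning algorithm mapping a dataset to parameters in $\mathbb{R}^d$; $\mathcal{D}$ is the training dataset, $\mathcal{D}_f\subset\mathcal{D}$ the forget set, $\mathcal{D}_r=\mathcal{D}\setminus\mathcal{D}_f$ the retained set; $\hat{\mathbf{x}}=\mathcal{A}(\mathcal{D})$ and $\hat{\mathbf{x}}'=\mathcal{A}(\mathcal{D}_r)$, trained under a fixed coupling of their randomness. Initial discrepancy. For $\rho\in(0,1]$, $\Delta(\rho)$ is the smallest value with $\Pr[\|\hat{\mathbf{x}}-\hat{\mathbf{x}}'\|\le\Delta(\rho)]\ge1-\rho$ (Euclidean norm). It is treated as a conditioning parameter: the guarantee is interpreted for a given instantiated value of $\Delta(\rho)$, under the proximity condition it expresses. $(\varepsilon,\delta)$-unlearning. An unlearning mechanism $\mathcal{U}$ is an $(\varepsilon,\delta)$-unlearning algorithm for $\mathcal{A}$ if there is a certifying algorithm $\bar{\mathcal{A}}$ such that for any forget set $\mathcal{D}_f\subset\mathcal{D}$ and any $O\subset\mathbb{R}^d$, $$\Pr[\mathcal{U}(\mathcal{A}(\mathcal{D}),\mathcal{D},\mathcal{D}_f)\in O]\le e^{\varepsilon}\Pr[\bar{\mathcal{A}}(\mathcal{D}\setminus\mathcal{D}_f)\in O]+\delta,\qquad \Pr[\bar{\mathcal{A}}(\mathcal{D}\setminus\mathcal{D}_f)\in O]\le e^{\varepsilon}\Pr[\mathcal{U}(\mathcal{A}(\mathcal{D}),\mathcal{D},\mathcal{D}_f)\in O]+\delta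 .$$ Here the certifying algorithm is $\bar{\mathcal{A}}(\mathcal{D}\setminus\mathcal{D}_f)=\mathcal{U}(\mathcal{A}(\mathcal{D}_r),\mathcal{D}_r,\varnothing)$. Noisy fine-tuning. With learning rate $\gamma>0$, weight decay $\lambda\ge0$, $\gamma\lambda<1$, and clipping radii $C_0,C_1>0$: $\mathbf{x}_0=\Pi_{C_0}(\hat{\mathbf{x}})$ and $\mathbf{x}_{t+1}=\mathbf{x}_t-\gamma(\Pi_{C_1}(g_t)+\lambda\mathbf{x}_t)+\boldsymbol{\xi}_{t+1}$, where $g_t$ is the gradient at step $t$ computed on $\mathcal{D}_r$, $\boldsymbol{\xi}_{t+1}$ is Gaussian noise with covariance $\sigma^2$ times the identity, and $\Pi_C(\mathbf{v})=\mathbf{v}\cdot\min\{C/\|\mathbf{v}\|,1\}$. Block-wise noisy fine-tuning. Inputs: the model $\hat{\mathbf{x}}$, the parameters $\gamma,\lambda,\Delta(\rho),C_1$, the number of blocks $k$ and the privacy budget parameters. Decompose $\hat{\mathbf{x}}=\sum_{i=1}^kA_iB_i$ (the $A_i$ are fixed and not trained). For $i=1,\dots,k$ in turn: freeze all parameters except $B_i$; calculate the noise variance $\sigma^2$ and the number of steps $T$ for the budget of this block by the noisy-fine-tuning noise formula with $C_0$ replaced by $\Delta(\rho)/2$ (given below); apply noisy fine-tuning to $B_i$, with noise in $\mathbb{R}^{r_i}$, without the initial model-clipping step. Finally, run several standard fine-tuning steps with all parameters unfrozen. Noise formula. In terms of $C_0$, the noise variance must satisfy $\sigma^2\ge\gamma(2-\gamma\lambda)\frac{2q}{\varepsilon^{\text{rényi}}}\bigl(2-\frac{\lambda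 C_0}{C_1}\bigr)C_0C_1$ if $\frac{\lambda C_0}{C_1}\in(0,1)$ and $\sigma^2>\gamma(2-\gamma\lambda)\frac{2q}{\varepsilon^{\text{rényi}}}\frac{C_1^2}{\lambda}$ if $\frac{\lambda C_0}{C_1}\in[1,\infty)$; in the first regime, for the minimal feasible noise, the number of steps is $T=\log\bigl(1-\frac{\lambda C_0}{C_1}\bigr)/\log(1-\gamma\lambda)$. *)

(* Defs.v *)
From HB Require Import structures.
From mathcomp Require Import all_boot all_order all_algebra finmap.
From mathcomp Require Import all_classical all_reals all_analysis.

Set Implicit Arguments.
Unset Strict Implicit.
Unset Printing Implicit Defensive.

Import Order.TTheory GRing.Theory Num.Theory.
Import numFieldNormedType.Exports.

Local Open Scope classical_set_scope.
Local Open Scope ring_scope.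

(* The Borel sigma-algebra of R^n is built as the product sigma-algebra, as the
   library does for n.-tuple. *)

Definition cV_display : measure_display. Proof. exact: default_measure_display. Qed.

Section measurable_cV.
Context (R : realType) (n : nat).

Let coor (i : 'I_n) (v : 'cV[R]_n) : R := v i 0.

Let cV_set0 : g_sigma_preimage coor set0.
Proof. exact: sigma_algebra0. Qed.

Let cV_setC A : g_sigma_preimage coor A -> g_sigma_preimage coor (~` A).
Proof. exact: sigma_algebraC. Qed.

Let cV_bigcup (F : (set 'cV[R]_n)^nat) :
  (forall i, g_sigma_preimage coor (F i)) ->
  g_sigma_preimage coor (\bigcup_i (F i)).
Proof. exact: sigma_algebra_bigcup. Qed.

HB.instance Definition _ := @isMeasurable.Build cV_display
  'cV[R]_n (g_sigma_preimage coor) cV_set0 cV_setC cV_bigcup.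

End measurable_cV.

Section euclidean.
Context {R : realType} {n : nat}.
Implicit Types (v : 'cV[R]_n) (f : 'cV[R]_n -> R).

(* The norm `|v| of the library is the sup norm. *)
Definition enorm v : R := Num.sqrt (\sum_(i < n) v i 0 ^+ 2).

(* For v = 0 the quotient C / 0 is 0 and the result is 0, as it should be. *)
Definition clip (C : R) v : 'cV[R]_n := Num.min (C / enorm v) 1 *: v.

Definition grad f v : 'cV[R]_n := \col_(j < n) 'D_(delta_mx j 0) f v.

End euclidean.

Section probability.
Context {R : realType} {d : measure_display} {T : measurableType d}.
Variable P : probability T R.

Definition law {S : Type} (X : T -> S) (O : set S) : R := fine (P (X @^-1` O)).

(* When E is negligible the quotient by 0 is 0, and this is not a probability. *)
Definition law_given {S : Type} (E : set T) (X : T -> S) (O : set S) : R :=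
  fine (P (X @^-1` O `&` E)) / fine (P E).

Definition isotropic_gaussian (sigma : R) {n : nat} (X : T -> 'cV[R]_n) : Prop :=
  forall B : 'I_n -> set R, (forall j, measurable (B j)) ->
    law X [set v | forall j, B j (v j 0)] =
    \prod_(j < n) fine (normal_prob 0 sigma (B j)).

Definition mutually_independent {I : eqType} {d' : measure_display}
    (S : I -> measurableType d') (X : forall i, T -> S i) : Prop :=
  forall (J : seq I) (B : forall i, set (S i)),
    uniq J -> (forall i, measurable (B i)) ->
    fine (P [set w | forall i, i \in J -> B i (X i w)]) =
    \prod_(i <- J) law (X i) (B i).

Definition block_noise {k : nat} {r : 'I_k -> nat} (sigma : 'I_k -> R)
    (xi : forall i : 'I_k, nat -> T -> 'cV[R]_(r i)) : Prop :=
  (forall i t, isotropic_gaussian (sigma i) (xi i t)) /\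
  mutually_independent
    (S := fun p : 'I_k * nat => 'cV[R]_(r p.1)) (fun p => xi p.1 p.2).

(* The smallest x with P[|X - Y| <= x] >= 1 - rho. *)
Definition initial_discrepancy {n : nat} (X Y : T -> 'cV[R]_n) (rho : R) : R :=
  inf [set x | 0 <= x /\ 1 - rho <= fine (P [set w | enorm (X w - Y w) <= x])].

End probability.

Section unlearning.
Context {R : realType} {Z : choiceType} {n : nat}.
Context {da du : measure_display}.
Context {Wa : measurableType da} {Wu : measurableType du}.
Context {Pa : probability Wa R} {Pu : probability Wu R}.

(* All the models are functions of one sample in Wa: this is the coupling of the
   randomness of the trainings on different datasets. The sample of the
   unlearning mechanism, in Wu, is independent of it. *)
Variable A : {fset Z} -> {RV Pa >-> 'cV[R]_n}.
Variable U : 'cV[R]_n -> {fset Z} -> {fset Z} -> Wu -> 'cV[R]_n.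

Local Notation PP := (Pa \x Pu)%E.

Definition unlearned (D Df : {fset Z}) (w : Wa * Wu) : 'cV[R]_n :=
  U (A D w.1) D Df w.2.

Definition indistinguishable (eps delta : R) (mu nu : set 'cV[R]_n -> R) : Prop :=
  forall O, measurable O ->
    mu O <= expR eps * nu O + delta /\ nu O <= expR eps * mu O + delta.

Definition certifying_algorithm (Abar : {fset Z} -> {RV PP >-> 'cV[R]_n}) :=
  forall S w, Abar S w = unlearned S fset0 w.

Definition unlearning (D : {fset Z}) (eps delta : R) : Prop :=
  exists2 Abar : {fset Z} -> {RV PP >-> 'cV[R]_n}, certifying_algorithm Abar &
    forall Df, (Df `<=` D)%fset ->
      indistinguishable eps delta
        (law PP (unlearned D Df)) (law PP (Abar (D `\` Df)%fset)).

Definition proximity (D Df : {fset Z}) (Delta : R) : set (Wa * Wu) :=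
  [set w | enorm (A D w.1 - A (D `\` Df)%fset w.1) <= Delta].

(* The guarantee for an instantiated value Delta of the initial discrepancy, at
   confidence 1 - rho, conditionally on the two models being Delta-close. *)
Definition unlearning_under_proximity (rho Delta : R) (D : {fset Z})
    (eps delta : R) : Prop :=
  exists2 Abar : {fset Z} -> {RV PP >-> 'cV[R]_n}, certifying_algorithm Abar &
    forall Df, (Df `<=` D)%fset ->
      initial_discrepancy Pa (A D) (A (D `\` Df)%fset) rho <= Delta ->
      indistinguishable eps delta
        (law_given PP (proximity D Df Delta) (unlearned D Df))
        (law_given PP (proximity D Df Delta) (Abar (D `\` Df)%fset)).

End unlearning.

Section noisy_finetuning.
Context {R : realType} {n : nat}.
Variables (gamma lambda C1 : R).
Variable g : nat -> 'cV[R]_n -> 'cV[R]_n.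
Variable xi : nat -> 'cV[R]_n.

Fixpoint noisy_finetuning (x0 : 'cV[R]_n) (T : nat) : 'cV[R]_n :=
  if T is t.+1 then
    let x := noisy_finetuning x0 t in
    x - gamma *: (clip C1 (g t x) + lambda *: x) + xi t.+1
  else x0.

End noisy_finetuning.

Section calibration.
Context {R : realType}.
(* A sufficient number of steps for the regime 1 <= c, as a function of
   gamma, lambda, C0, C1, q, epsR, sigma. *)
Variable Tmin : R -> R -> R -> R -> R -> R -> R -> nat.

(* epsR is the Renyi budget of order q. *)
Definition calibrated (gamma lambda C0 C1 q epsR sigma : R) (T : nat) : Prop :=
  let c := lambda * C0 / C1 in
  let K := gamma * (2 - gamma * lambda) * (2 * q / epsR) in
  [/\ 0 < c < 1,
      K * (2 - c) * C0 * C1 <= sigma ^+ 2 &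
      T%:R = ln (1 - c) / ln (1 - gamma * lambda)]
  \/
  [/\ 1 <= c,
      K * (C1 ^+ 2 / lambda) < sigma ^+ 2 &
      (Tmin gamma lambda C0 C1 q epsR sigma <= T)%N].

End calibration.

Section blockwise.
Context {R : realType} {d k : nat} {r : 'I_k -> nat}.
Variable A : forall i : 'I_k, 'M[R]_(d, r i).

Definition block (i : 'I_k) (W : 'cV[R]_d) : 'cV[R]_(r i) := (A i)^T *m W.

(* The parameters of W with the i-th block replaced by b, the others frozen. *)
Definition set_block (i : 'I_k) (W : 'cV[R]_d) (b : 'cV[R]_(r i)) : 'cV[R]_d :=
  A i *m b + \sum_(j < k | j != i) A j *m block j W.

(* The gradient with respect to B_i alone, at B_i = A_i^T W. *)
Definition block_grad (i : 'I_k) (f : 'cV[R]_d -> R) (W : 'cV[R]_d) :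
    'cV[R]_(r i) :=
  grad (fun b => f (set_block W b)) (block i W).

Context {Z : choiceType} {Wu : Type}.
Variables (gamma lambda C1 : R) (T : 'I_k -> nat).
(* loss S i t is the objective on the dataset S at step t of block i. *)
Variable loss : {fset Z} -> 'I_k -> nat -> 'cV[R]_d -> R.
Variable xi : forall i : 'I_k, nat -> Wu -> 'cV[R]_(r i).
(* The final fine-tuning: ft S s is the s-th of m updates, on the dataset S. *)
Variables (ft : {fset Z} -> nat -> 'cV[R]_d -> 'cV[R]_d) (m : nat).

Definition finetune_block (S : {fset Z}) (w : Wu) (W : 'cV[R]_d) (i : 'I_k) :
    'cV[R]_d :=
  set_block W
    (noisy_finetuning gamma lambda C1
      (fun t b => block_grad i (loss S i t) (set_block W b))
      (fun t => xi i t w) (block i W) (T i)).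

Definition blockwise_finetuning (S : {fset Z}) (w : Wu) (W : 'cV[R]_d) :
    'cV[R]_d :=
  foldl (fun V s => ft S s V)
    (foldl (finetune_block S w) W (enum 'I_k)) (iota 0 m).

Definition blockwise_unlearning (x : 'cV[R]_d) (D Df : {fset Z}) (w : Wu) :=
  blockwise_finetuning (D `\` Df)%fset w x.

Definition clipped_blockwise_unlearning (C0 : R) (x : 'cV[R]_d)
    (D Df : {fset Z}) (w : Wu) :=
  blockwise_unlearning (clip C0 x) D Df w.

End blockwise.

(* Main.v *)
(* Run the unlearning mechanism from the two models x and y with the same
   Gaussian noise z, and pull the second trajectory towards the first one by
   shifting its noise: at each step of block i the difference of the i-th blocks,
   which the clipped gradient step maps from norm u to norm at most
   (1 - gamma lambda) u + 2 gamma C1, is clipped to a radius a_t and subtracted.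
   With radii growing like (1 - gamma lambda)^-t the difference vanishes at the end
   of the block, and the calibration of the noise says that
   q sum_t a_t^2 / (2 sigma_i^2) is at most the Renyi budget of block i. The other
   blocks contribute nothing: frozen blocks keep their difference, and clipping
   makes the bound insensitive to their values in the gradients. So the output
   from x is the output from y for the noise z + s(z), where each shift depends on
   earlier noises only. By Girsanov's theorem, the weight w(z) turns the law of
   z + s(z) into that of z, and E w^-(q-1) <= exp((q-1) B), B being the sum of the
   budgets. Since 1 <= w e^eps + (w e^eps)^-(q-1) pointwise, this gives the
   (eps, delta) bound with eps = B + log(1/delta)/(q-1) for fixed x and y, and
   integrating over the coupling of the trainings concludes. *)

Require Import Defs.
From HB Require Import structures.
From mathcomp Require Import all_boot all_order all_algebra finmap.
From mathcomp Require Import all_classical all_reals all_analysis.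
From mathcomp Require Import measurable_realfun ring lra.

Set Implicit Arguments.
Unset Strict Implicit.
Unset Printing Implicit Defensive.

Import Order.TTheory GRing.Theory Num.Theory.
Import numFieldNormedType.Exports.

Local Open Scope classical_set_scope.
Local Open Scope ring_scope.

(** * Translation of one-dimensional Gaussian laws *)

Section gaussian_shift.
Context {R : realType}.
Local Notation mu := (@lebesgue_measure R).
Local Open Scope ereal_scope.

Lemma lebesgue_measure_shift (s : R) (A : set R) : measurable A ->
  pushforward mu (fun x : measurableTypeR R => (x + s)%R : measurableTypeR R) A
  = mu A.
Proof.
have ms : measurable_fun [set: measurableTypeR R]
    (fun x : measurableTypeR R => (x + s)%R : measurableTypeR R).
  exact: measurable_funD.
pose mms := isMeasurableFun.Build _ _ _ _ _ ms.
pose fs : {mfun measurableTypeR R >-> measurableTypeR R} :=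
  HB.pack (fun x : measurableTypeR R => (x + s)%R : measurableTypeR R) mms.
move=> mA; apply/esym.
apply: (lebesgue_measure_unique (mu := pushforward mu fs)) => //= _ [[a b]] _ <-.
rewrite /pushforward /=.
have -> : (fun x : R => (x + s)%R) @^-1` [set` `]a, b]%R] =
    [set` `](a - s)%R, (b - s)%R]%R].
  by apply/seteqP; split=> x /=; rewrite !in_itv/= ltrBlDr lerBrDr.
by rewrite !lebesgue_measure_itv/= !lte_fin ltrD2r -!EFinB opprB addrA subrK.
Qed.

Lemma ge0_integral_lebesgue_shift (s : R) (f : R -> \bar R) :
  measurable_fun setT f -> (forall x, 0 <= f x) ->
  \int[mu]_x f (x + s)%R = \int[mu]_x f x.
Proof.
move=> mf f0.
have ms : measurable_fun [set: measurableTypeR R]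
    (fun x : measurableTypeR R => (x + s)%R : measurableTypeR R).
  exact: measurable_funD.
have := @ge0_integral_pushforward _ _ _ _ R _ ms mu setT f measurableT mf
  (fun y _ => f0 y).
rewrite preimage_setT => <-.
by apply: eq_measure_integral => A mA _; exact: lebesgue_measure_shift.
Qed.

(** The Radon-Nikodym derivative of the normal law and [normal_pdf] have the same integral over
    every measurable set, hence agree almost everywhere. *)
Lemma ge0_integral_normal_prob (m sigma : R) (f : R -> \bar R) :
  sigma != 0%R -> measurable_fun setT f -> (forall x, 0 <= f x) ->
  \int[normal_prob m sigma]_x f x =
  \int[mu]_x (f x * (normal_pdf m sigma x)%:E).
Proof.
move=> s0 mf f0.
have dom := normal_prob_dominates m sigma.
have mh := Radon_Nikodym_SigmaFinite.f_integrable dom.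
rewrite -(Radon_Nikodym_SigmaFinite.change_of_variables dom)//=.
apply: ae_eq_integral => //.
- by apply: emeasurable_funM => //; exact: (measurable_int mu).
- apply: emeasurable_funM => //; apply/measurable_EFinP.
  exact: measurable_normal_pdf.
- apply: ae_eqe_mul2l => /=.
  apply: integral_ae_eq => //=.
  + by apply/measurable_EFinP; exact: measurable_normal_pdf.
  + by move=> E _ mE; rewrite -Radon_Nikodym_SigmaFinite.f_integral.
Qed.

(* Cameron-Martin in dimension one: the exponential is the density of
   N(0, sigma^2) with respect to N(s, sigma^2), read at the point x + s. *)
Lemma normal_prob_shift (sigma s : R) (f : R -> \bar R) :
  sigma != 0%R -> measurable_fun setT f -> (forall x, 0 <= f x) ->
  \int[normal_prob 0 sigma]_x
    (f (x + s)%R * (expR (- (2 * x * s + s ^+ 2) / (2 * sigma ^+ 2)))%:E) =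
  \int[normal_prob 0 sigma]_x f x.
Proof.
move=> s0 mf f0.
have mfs : measurable_fun setT (fun x : R => f (x + s)%R).
  by apply: measurableT_comp => //; exact: measurable_funD.
have mw : measurable_fun setT
    (fun x : R => expR (- (2 * x * s + s ^+ 2) / (2 * sigma ^+ 2))).
  apply: measurableT_comp => //; apply: measurable_funM => //.
  apply: measurableT_comp => //; apply: measurable_funD => //.
  by apply: measurable_funM => //; exact: measurable_funM.
rewrite !ge0_integral_normal_prob//; first last.
- by move=> x; rewrite mule_ge0// lee_fin expR_ge0.
- by apply: emeasurable_funM => //; exact/measurable_EFinP.
(* After translating the right-hand side by [s] the integrands agree pointwise: the exponential
   times the density at [x] is the density at [x + s]. *)
rewrite -[RHS](ge0_integral_lebesgue_shift s); first last.
- by move=> x; rewrite mule_ge0// lee_fin normal_pdf_ge0.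
- apply: emeasurable_funM => //; apply/measurable_EFinP.
  exact: measurable_normal_pdf.
apply: eq_integral => x _; rewrite -muleA; congr (_ * _).
rewrite -EFinM; congr EFin; rewrite !normal_pdfE// /normal_fun mulrCA -expRD.
by congr (_ * expR _)%R; field.
Qed.

End gaussian_shift.

(** * Real families with the product sigma-algebra, and their finite cylinders *)

Definition noise_display : measure_display.
Proof. exact: default_measure_display. Qed.

(** The alias gives [I -> R] the sigma-algebra generated by its coordinates, for an index type that
    may be infinite. *)
Definition noise (R : realType) (I : Type) : Type := I -> R.

Section noise_measurable.
Context (R : realType) (I : Type).

HB.instance Definition _ := Pointed.copy (noise R I) (I -> R).

Definition noise_cylinder1 : set (set (noise R I)) :=
  [set A | exists i, exists2 B : set R,
    measurable B & A = (fun z : noise R I => z i) @^-1` B].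

Let noise_set0 : <<s noise_cylinder1 >> set0.
Proof. exact: sigma_algebra0. Qed.

Let noise_setC A : <<s noise_cylinder1 >> A -> <<s noise_cylinder1 >> (~` A).
Proof. exact: sigma_algebraC. Qed.

Let noise_bigcup (F : (set (noise R I))^nat) :
  (forall i, <<s noise_cylinder1 >> (F i)) ->
  <<s noise_cylinder1 >> (\bigcup_i (F i)).
Proof. exact: sigma_algebra_bigcup. Qed.

HB.instance Definition _ := @isMeasurable.Build noise_display
  (noise R I) <<s noise_cylinder1 >> noise_set0 noise_setC noise_bigcup.

Lemma measurable_noise_coord (i : I) :
  measurable_fun [set: noise R I] (fun z : noise R I => z i).
Proof.
by move=> _ B mB; rewrite setTI; apply: sub_sigma_algebra; exists i, B.
Qed.

Lemma measurable_noiseP d (T : measurableType d) (f : T -> noise R I) :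
  (forall i, measurable_fun [set: T] (fun w => f w i)) ->
  measurable_fun [set: T] f.
Proof.
move=> mf; apply: (measurability noise_cylinder1) => //.
by move=> _ [_ [i [B mB ->]] <-]; exact: mf.
Qed.

End noise_measurable.

Section noise_cylinder.
Context {R : realType} {I : eqType}.
Local Notation noise := (noise R I).

Definition noise_cylinder (J : seq I) (B : I -> set R) : set noise :=
  [set z | forall i, i \in J -> B i (z i)].

Lemma noise_cylinder_nil B : noise_cylinder [::] B = setT.
Proof. by apply/seteqP; split. Qed.

Lemma noise_cylinder_cons i J B :
  noise_cylinder (i :: J) B = (fun z : noise => z i) @^-1` B i `&`
                              noise_cylinder J B.
Proof.
apply/seteqP; split=> z /=.
  move=> h; split; first by apply: h; rewrite mem_head.
  by move=> j jJ; apply: h; rewrite inE jJ orbT.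
by move=> [h1 h2] j; rewrite inE => /orP[/eqP->//|]; exact: h2.
Qed.

Lemma measurable_noise_cylinder J B :
  (forall i, measurable (B i)) -> measurable (noise_cylinder J B).
Proof.
move=> mB; elim: J => [|i J ih]; first by rewrite noise_cylinder_nil.
rewrite noise_cylinder_cons; apply: measurableI => //.
by rewrite -[X in measurable X]setTI; exact: measurable_noise_coord.
Qed.

(** A pi-system generating the sigma-algebra: a probability on [noise] is determined by its values
    here. *)
Definition noise_cylinders : set (set noise) :=
  [set A | exists J, exists2 B : I -> set R,
    forall i, measurable (B i) & A = noise_cylinder J B].

Lemma noise_cylinders_setI : setI_closed noise_cylinders.
Proof.
move=> _ _ [J1 [B1 mB1 ->]] [J2 [B2 mB2 ->]].
exists (J1 ++ J2), (fun i => (if i \in J1 then B1 i else setT) `&`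
                             (if i \in J2 then B2 i else setT)).
  by move=> i; apply: measurableI; case: ifP.
apply/seteqP; split=> z /=.
  by move=> [h1 h2] i _; split; case: ifP => // iJ; [exact: h1|exact: h2].
move=> h; split=> i iJ.
  by have := h i; rewrite mem_cat iJ => /(_ isT)[].
by have := h i; rewrite mem_cat iJ orbT => /(_ isT)[].
Qed.

Lemma noise_cylinders_generate :
  @measurable _ noise = <<s noise_cylinders >>.
Proof.
apply/seteqP; split.
  apply: smallest_sub; first exact: smallest_sigma_algebra.
  move=> _ [i [B mB ->]]; apply: sub_sigma_algebra.
  exists [:: i], (fun=> B) => //.
  apply/seteqP; split=> z /=; first by move=> h j; rewrite inE => /eqP->.
  by apply; rewrite mem_head.
apply: smallest_sub; first exact: sigma_algebra_measurable.
by move=> _ [J [B mB ->]]; exact: measurable_noise_cylinder.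
Qed.

Definition update (e : I) (z : noise) (x : R) : noise :=
  fun i => if i == e then x else z i.

Lemma measurable_update e :
  measurable_fun setT (fun p : noise * measurableTypeR R => update e p.1 p.2).
Proof.
apply: measurable_noiseP => i; rewrite /update; case: eqVneq => _.
  exact: measurable_snd.
exact: (measurableT_comp (measurable_noise_coord i) measurable_fst).
Qed.

End noise_cylinder.

(** * Girsanov's theorem for predictable shifts of independent Gaussian coordinates *)

Section gaussian_noise.
Context {R : realType} {I : eqType}.
Local Notation noise := (noise R I).
Variables (mu : probability noise R) (sigma : I -> R).
Hypothesis sigma_neq0 : forall i, sigma i != 0.
Hypothesis mu_cylinder : forall J B, uniq J -> (forall i, measurable (B i)) ->
  mu (noise_cylinder J B) = (\prod_(i <- J) normal_prob 0 (sigma i) (B i))%E.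
Local Open Scope ereal_scope.

(** Independence of coordinate [e] from the others: redrawing it from its own law does not change
    [mu]. The two measures need only be compared on cylinders. *)
Lemma gaussian_noise_resample (e : I) (f : noise -> \bar R) :
  measurable_fun setT f -> (forall z, 0 <= f z) ->
  \int[mu]_z f z =
  \int[mu]_z \int[normal_prob 0 (sigma e)]_x f (update e z x).
Proof.
move=> mf f0.
pose upd (p : noise * measurableTypeR R) := update e p.1 p.2.
have mupd : measurable_fun setT upd := measurable_update e.
pose mmupd := isMeasurableFun.Build _ _ _ _ _ mupd.
pose fupd : {mfun (noise * measurableTypeR R)%type >-> noise} :=
  HB.pack upd mmupd.
pose nu := pushforward (mu \x normal_prob 0 (sigma e)) fupd.
have mu_nu A : measurable A -> mu A = nu A.
  move=> mA; apply: (measure_unique noise_cylinders (fun=> setT)) => //.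
  - exact: noise_cylinders_generate.
  - exact: noise_cylinders_setI.
  - by move=> _; exists [::], (fun=> setT) => //; rewrite noise_cylinder_nil.
  - by rewrite bigcup_const.
  - move=> _ [J [B mB ->]].
    wlog uJ : J / uniq J.
      have -> : noise_cylinder J B = noise_cylinder (undup J) B.
        by apply/seteqP; split=> z h i; move: (h i); rewrite mem_undup.
      by apply; exact: undup_uniq.
    (* Resampling moves the constraint on coordinate [e], if any, to the fresh variable: the
       preimage of the cylinder is a rectangle. *)
    rewrite [RHS](_ : _ =
        (mu \x normal_prob 0 (sigma e))
          (noise_cylinder (rem e J) B `*` (if e \in J then B e else setT)));
      last first.
      rewrite /pushforward; congr (product_measure1 _ _ _).
      apply/seteqP; split=> -[z x] /=.
        move=> h; split=> [i|].
          rewrite mem_rem_uniq// inE/= => /andP[ie iJ].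
          by have := h i iJ; rewrite /upd /update/= (negbTE ie).
        case: ifPn => // eJ.
        by have := h e eJ; rewrite /upd /update/= eqxx.
      move=> [h1 h2] i iJ; rewrite /upd /update/=; case: eqVneq iJ => [->|ie] iJ.
        by rewrite iJ in h2.
      by apply: h1; rewrite mem_rem_uniq// inE/= ie.
    have mBe : measurable (if e \in J then B e else setT) by case: ifP.
    rewrite product_measure1E//; last exact: measurable_noise_cylinder.
    case: ifPn => eJ; last first.
      by rewrite [X in _ * X]probability_setT mule1 rem_id.
    apply: (etrans (mu_cylinder uJ mB)).
    rewrite (perm_big _ (perm_to_rem eJ)) big_cons muleC.
    congr (_ * _); apply/esym/mu_cylinder => //.
    exact: rem_uniq.
  - by move=> _; apply: (le_lt_trans (probability_le1 mu measurableT)); rewrite ltry.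
transitivity (\int[nu]_z f z).
  by apply: eq_measure_integral => A mA _; exact: mu_nu.
rewrite [LHS](ge0_integral_pushforward mupd)// preimage_setT fubini_tonelli1//.
  exact: measurableT_comp.
by move=> p; exact: f0.
Qed.

Definition shift_noise (s : I -> noise -> R) (E : seq I) (z : noise) : noise :=
  fun i => (z i + (if i \in E then s i z else 0))%R.

Definition girsanov_weight (s : I -> noise -> R) (E : seq I) (z : noise) : R :=
  (\prod_(i <- E)
    expR (- (2 * z i * s i z + s i z ^+ 2) / (2 * sigma i ^+ 2)))%R.

(* The coordinates are listed in E from the latest to the earliest one. *)
Fixpoint predictable (s : I -> noise -> R) (E : seq I) : Prop :=
  if E is e :: E' then
    [/\ e \notin E',
        forall i z x, i \in E -> s i (update e z x) = s i z &
        predictable s E']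
  else True.

Lemma measurable_shift_noise s E : (forall i, measurable_fun setT (s i)) ->
  measurable_fun setT (shift_noise s E).
Proof.
move=> ms; apply: measurable_noiseP => i; apply: measurable_funD.
  exact: measurable_noise_coord.
by case: (i \in E).
Qed.

Lemma girsanov_weight_cons s e E z : girsanov_weight s (e :: E) z =
  (expR (- (2 * z e * s e z + s e z ^+ 2) / (2 * sigma e ^+ 2)) *
   girsanov_weight s E z)%R.
Proof. by rewrite /girsanov_weight big_cons. Qed.

Lemma girsanov_weight_ge0 s E z : (0 <= girsanov_weight s E z)%R.
Proof. by apply: prodr_ge0 => i _; exact: expR_ge0. Qed.

Lemma measurable_girsanov_weight s E : (forall i, measurable_fun setT (s i)) ->
  measurable_fun setT (girsanov_weight s E).
Proof.
move=> ms; apply: measurable_prod => i _; apply: measurableT_comp => //.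
apply: measurable_funM => //; apply: measurableT_comp => //.
apply: measurable_funD; last exact: measurable_funX.
apply: measurable_funM => //; apply: measurable_funM => //.
exact: measurable_noise_coord.
Qed.

(** By induction on [E], removing the latest coordinate [e]. No shift of the list reads it, so once
    the other coordinates are fixed [s e z] is a constant, and the one-dimensional translation
    removes the factor of [e] from the weight. *)
Lemma girsanov s E (f : noise -> \bar R) :
  (forall i, measurable_fun setT (s i)) -> predictable s E ->
  measurable_fun setT f -> (forall z, 0 <= f z) ->
  \int[mu]_z (f (shift_noise s E z) * (girsanov_weight s E z)%:E) =
  \int[mu]_z f z.
Proof.
move=> ms + mf f0; elim: E => [_|e E ih [eE se /[dup] pE /ih {}ih]].
  apply: eq_integral => z _; rewrite /girsanov_weight big_nil mule1.
  by congr f; apply/funext => i; rewrite /shift_noise in_nil addr0.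
have mF E' : measurable_fun setT
    (fun z => f (shift_noise s E' z) * (girsanov_weight s E' z)%:E).
  apply: emeasurable_funM.
    exact: (measurableT_comp mf (measurable_shift_noise _ ms)).
  by apply/measurable_EFinP; exact: measurable_girsanov_weight.
have F0 E' z : 0 <= f (shift_noise s E' z) * (girsanov_weight s E' z)%:E.
  by rewrite mule_ge0// lee_fin girsanov_weight_ge0.
have shiftE i z x : i \in E -> s i (update e z x) = s i z.
  by move=> iE; rewrite se// inE iE orbT.
have weightE z x : girsanov_weight s E (update e z x) = girsanov_weight s E z.
  apply: eq_big_seq => i iE; rewrite shiftE// /update ifN//.
  by apply: contraNneq eE => <-.
(* The integrals for [e :: E] and for [E] are compared after redrawing coordinate [e] in both. *)
apply: (etrans _ ih).
apply: (etrans (gaussian_noise_resample e (mF (e :: E)) (F0 (e :: E)))).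
apply: (etrans _ (esym (gaussian_noise_resample e (mF E) (F0 E)))).
apply: eq_integral => z _; pose g x :=
  f (update e (shift_noise s E z) x) * (girsanov_weight s E z)%:E.
transitivity (\int[normal_prob 0 (sigma e)]_x (g (x + s e z)%R *
    (expR (- (2 * x * s e z + s e z ^+ 2) / (2 * sigma e ^+ 2)))%:E)).
  apply: eq_integral => x _; rewrite /g -muleA -EFinM girsanov_weight_cons.
  rewrite mulrC weightE se ?mem_head// {2 3}/update eqxx; congr (f _ * _).
  apply/funext => i; rewrite /shift_noise inE /update; case: eqVneq => [->|ie] /=.
    by rewrite se ?mem_head.
  by case: ifPn => // iE; rewrite shiftE.
have mg : measurable_fun setT g.
  apply: emeasurable_funM => //; apply: (measurableT_comp mf).
  by apply: measurable_noiseP => i; rewrite /update; case: (i == e).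
have g0 x : 0 <= g x by rewrite /g mule_ge0// lee_fin girsanov_weight_ge0.
apply: (etrans (normal_prob_shift (s e z) (sigma_neq0 e) mg g0)).
apply: eq_integral => x _; rewrite /g weightE; congr (f _ * _).
apply/funext => i; rewrite /shift_noise /update; case: eqVneq => [->|ie].
  by rewrite (negbTE eE) addr0.
by case: ifPn => // iE; rewrite shiftE.
Qed.

(* Multiplying the shifts by - (q - 1) turns the power - (q - 1) of the Girsanov
   weight into another Girsanov weight, which integrates to 1, times the
   exponential of the energy of the shifts. *)
Lemma renyi_shift_noise s E (q delta B : R) (S : set noise) :
  (forall i, measurable_fun setT (s i)) -> predictable s E ->
  (1 < q)%R -> (0 < delta)%R ->
  (forall z, \sum_(i <- E) q * s i z ^+ 2 / (2 * sigma i ^+ 2) <= B)%R ->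
  measurable S ->
  mu (shift_noise s E @^-1` S) <=
    (expR (B + ln delta^-1 / (q - 1)))%:E * mu S + delta%:E.
Proof.
move=> ms ps q1 d0 sB mS; set eps := (B + _)%R.
pose s' i z := (- (q - 1) * s i z)%R.
have ms' i : measurable_fun setT (s' i) by exact: measurable_funM.
have ps' : predictable s' E.
  elim: E ps {sB} => //= e E ih [eE se pE]; split=> //; last exact: ih.
  by move=> i z x iE; rewrite /s' se.
(* For positive [v], either [v] or its power of exponent [- (q - 1)] is at least 1; here [v] is
   [expR eps * girsanov_weight s E z]. *)
have weightX z : (1 <= expR eps * girsanov_weight s E z +
    delta * girsanov_weight s' E z)%R.
  rewrite /girsanov_weight -!expR_sum.
  set L := (\sum_(i <- E) _)%R; set L' := (\sum_(i <- E) _)%R.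
  (* In fact [- (q - 1) * L - L'] is [q - 1] times the energy of the shifts, which [B] bounds. *)
  have LL' : (- (q - 1) * L <= L' + (q - 1) * B)%R.
    rewrite -lerBlDl mulr_sumr -sumrB (le_trans _ (ler_wpM2l _ (sB z)))//; last first.
      by rewrite subr_ge0 ltW.
    rewrite mulr_sumr ler_sum// => i _; rewrite /s' le_eqVlt; apply/orP; left.
    by apply/eqP; field; exact: sigma_neq0.
  have q1' : (0 < q - 1)%R by rewrite subr_gt0.
  (* This identity dictates the term [ln delta^-1 / (q - 1)] of [eps]. *)
  have -> : delta = expR (- (q - 1) * (eps - B))%R.
    rewrite /eps addrAC subrr add0r mulrC -mulrA mulrN mulVf ?gt_eqF//.
    by rewrite mulrN1 lnV ?posrE// opprK lnK.
  rewrite -!expRD; have [h|h] := leP 0%R (eps + L)%R.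
    apply: (@le_trans _ _ (expR (eps + L)%R)); first by rewrite -expR0 ler_expR.
    by rewrite lerDl expR_ge0.
  apply: (@le_trans _ _ (expR (- (q - 1) * (eps - B) + L')%R)); last first.
    by rewrite lerDr expR_ge0.
  rewrite -[leLHS]expR0 ler_expR; apply: (@le_trans _ _ (- (q - 1) * (eps + L))%R).
    by rewrite mulNr oppr_ge0 pmulr_rle0// ltW.
  by move: LL'; lra.
have mSs : measurable (shift_noise s E @^-1` S).
  by rewrite -[X in measurable X]setTI; exact: measurable_shift_noise.
have mind : measurable_fun setT (fun z : noise => (\1_S z : R)%:E).
  by apply/measurable_EFinP; exact: measurable_indic.
have mw := measurable_girsanov_weight E ms.
have mw' := measurable_girsanov_weight E ms'.
have mSw : measurable_fun setT (fun z : noise =>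
    (\1_S (shift_noise s E z) : R)%:E * (girsanov_weight s E z)%:E).
  apply: emeasurable_funM; last exact/measurable_EFinP.
  exact: (measurableT_comp mind (measurable_shift_noise _ ms)).
have Sw0 z : 0 <= (\1_S (shift_noise s E z) : R)%:E *
    (girsanov_weight s E z)%:E.
  by rewrite mule_ge0// lee_fin ?girsanov_weight_ge0.
have w0 z : 0 <= (girsanov_weight s' E z)%:E.
  by rewrite lee_fin girsanov_weight_ge0.
have iS : \int[mu]_z ((\1_S (shift_noise s E z) : R)%:E *
    (girsanov_weight s E z)%:E) = mu S.
  apply: (etrans (girsanov ms ps mind _)).
    by move=> z; rewrite lee_fin.
  by rewrite integral_indic// setIT.
have iw : \int[mu]_z (girsanov_weight s' E z)%:E = 1.
  transitivity (\int[mu]_z cst 1 z); last first.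
    by rewrite integral_cst// mul1e; exact: probability_setT.
  apply: (etrans _ (girsanov ms' ps' (measurable_cst 1) (fun=> lee01))).
  by apply: eq_integral => z _; rewrite mul1e.
have -> : mu (shift_noise s E @^-1` S) =
    \int[mu]_z (\1_(shift_noise s E @^-1` S) z : R)%:E.
  by rewrite integral_indic// setIT.
apply: (@le_trans _ _ (\int[mu]_z (
    (expR eps)%:E * ((\1_S (shift_noise s E z) : R)%:E *
      (girsanov_weight s E z)%:E) + delta%:E * (girsanov_weight s' E z)%:E))).
  apply: ge0_le_integral => //=.
  - by apply/measurable_EFinP; exact: measurable_indic.
  - apply: emeasurable_funD; apply: measurable_funeM => //.
    exact/measurable_EFinP.
  - move=> z _; rewrite -!EFinM -EFinD lee_fin !indicE.
    rewrite -[_ \in _ @^-1` _]/(shift_noise s E z \in S); case: (_ \in S); last first.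
      by rewrite mul0r mulr0 add0r mulr_ge0 ?girsanov_weight_ge0// ltW.
    by rewrite mul1r weightX.
rewrite ge0_integralD//; first last.
- by apply: measurable_funeM; exact/measurable_EFinP.
- by move=> z _; rewrite mule_ge0// lee_fin ltW.
- exact: measurable_funeM.
- by move=> z _; rewrite mule_ge0// lee_fin expR_ge0.
have emw' : measurable_fun setT (fun z : noise => (girsanov_weight s' E z)%:E).
  exact/measurable_EFinP.
have eps0 : 0 <= (expR eps)%:E by rewrite lee_fin expR_ge0.
have delta0 : 0 <= delta%:E by rewrite lee_fin ltW.
rewrite !ge0_integralZl//.
by rewrite iS iw mule1.
Qed.

End gaussian_noise.

(** * Measurability of vector operations *)

Section measurable_cV_theory.
Context {R : realType} {d : measure_display} {T : measurableType d}.

Lemma measurable_cV_coord n (j : 'I_n) :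
  measurable_fun [set: 'cV[R]_n] (fun v : 'cV[R]_n => v j 0).
Proof.
move=> _ Y mY; rewrite setTI; apply: sub_sigma_algebra => /=.
rewrite -bigcup_seq/=; exists j => /=; first by rewrite mem_index_enum.
by exists Y => //; rewrite setTI.
Qed.

Lemma measurable_cVP n (f : T -> 'cV[R]_n) :
  (forall j, measurable_fun [set: T] (fun w => f w j 0)) ->
  measurable_fun [set: T] f.
Proof.
move=> mf; apply: (measurability (\big[setU/set0]_(j < n)
  preimage_set_system setT (fun v : 'cV[R]_n => v j 0) measurable)) => //.
move=> _ [A + <-]; rewrite -bigcup_seq/= => -[j _ [B mB <-]].
rewrite !setTI -[X in measurable X]setTI.
exact: (mf j).
Qed.

Lemma measurable_cV_app n (f : T -> 'cV[R]_n) j :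
  measurable_fun setT f -> measurable_fun [set: T] (fun w => f w j 0).
Proof. exact: (measurableT_comp (measurable_cV_coord j)). Qed.

Lemma measurable_cVD n (f g : T -> 'cV[R]_n) : measurable_fun setT f ->
  measurable_fun setT g -> measurable_fun setT (fun w => f w + g w).
Proof.
move=> mf mg; apply: measurable_cVP => j; under eq_fun do rewrite mxE.
by apply: measurable_funD; exact: measurable_cV_app.
Qed.

Lemma measurable_cVZ n (c : T -> R) (f : T -> 'cV[R]_n) :
  measurable_fun setT c -> measurable_fun setT f ->
  measurable_fun setT (fun w => c w *: f w).
Proof.
move=> mc mf; apply: measurable_cVP => j; under eq_fun do rewrite mxE.
by apply: measurable_funM => //; exact: measurable_cV_app.
Qed.

Lemma measurable_cVB n (f g : T -> 'cV[R]_n) : measurable_fun setT f ->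
  measurable_fun setT g -> measurable_fun setT (fun w => f w - g w).
Proof.
move=> mf mg; apply: measurable_cVD => //.
by under eq_fun do rewrite -scaleN1r; exact: measurable_cVZ.
Qed.

Lemma measurable_mulmx m n (M : 'M[R]_(m, n)) (f : T -> 'cV[R]_n) :
  measurable_fun setT f -> measurable_fun setT (fun w => M *m f w).
Proof.
move=> mf; apply: measurable_cVP => j; under eq_fun do rewrite mxE.
apply: measurable_sum => i; apply: measurable_funM => //.
exact: measurable_cV_app.
Qed.

Lemma enorm_ge0 n (v : 'cV[R]_n) : 0 <= enorm v.
Proof. exact: sqrtr_ge0. Qed.

Lemma measurable_enorm n (f : T -> 'cV[R]_n) :
  measurable_fun setT f -> measurable_fun setT (fun w => enorm (f w)).
Proof.
move=> mf; have -> : (fun w => enorm (f w)) =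
    (fun w => (\sum_(i < n) f w i 0 ^+ 2) `^ 2^-1).
  apply/funext => w; rewrite powR12_sqrt// sumr_ge0// => i _.
  exact: sqr_ge0.
apply: (measurableT_comp (measurable_powR _)).
apply: measurable_sum => i; apply: measurable_funX; exact: measurable_cV_app.
Qed.

Lemma measurable_clip n C (f : T -> 'cV[R]_n) :
  measurable_fun setT f -> measurable_fun setT (fun w => clip C (f w)).
Proof.
move=> mf; apply: measurable_cVZ => //.
apply: measurable_minr => //; apply: measurable_funM => //.
have -> : (fun w => (enorm (f w))^-1) = (fun w => enorm (f w) `^ (-1)).
  by apply/funext => w; rewrite powR_inv1// enorm_ge0.
by apply: (measurableT_comp (measurable_powR _)); exact: measurable_enorm.
Qed.

End measurable_cV_theory.

(** * Euclidean norm and clipping *)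

Section euclidean_norm.
Context {R : realType} {n : nat}.
Implicit Types u v : 'cV[R]_n.

Lemma sqr_enorm v : enorm v ^+ 2 = \sum_(i < n) v i 0 ^+ 2.
Proof. by rewrite sqr_sqrtr// sumr_ge0// => i _; exact: sqr_ge0. Qed.

Lemma enorm_eq0 v : enorm v = 0 -> v = 0.
Proof.
move=> v0; have : \sum_(i < n) v i 0 ^+ 2 = 0 by rewrite -sqr_enorm v0 expr0n.
move=> /psumr_eq0P h; apply/colP => i; rewrite mxE; apply/eqP.
by rewrite -sqrf_eq0 h// => j _; exact: sqr_ge0.
Qed.

Lemma enormZ c v : enorm (c *: v) = `|c| * enorm v.
Proof.
rewrite /enorm; under eq_bigr do rewrite mxE exprMn.
by rewrite -mulr_sumr sqrtrM ?sqr_ge0// sqrtr_sqr.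
Qed.

Lemma enorm0 : enorm (0 : 'cV[R]_n) = 0.
Proof. by rewrite -(scale0r 0) enormZ normr0 mul0r. Qed.

(* Cauchy-Schwarz is [0 <= sum_i (|v| u_i - |u| v_i)^2]. *)
Lemma ler_enormD u v : enorm (u + v) <= enorm u + enorm v.
Proof.
have [u0|u0] := eqVneq (enorm u) 0.
  by rewrite (enorm_eq0 u0) add0r enorm0 add0r.
have [v0|v0] := eqVneq (enorm v) 0.
  by rewrite (enorm_eq0 v0) addr0 enorm0 addr0.
have pu : 0 < enorm u by rewrite lt_neqAle eq_sym u0 enorm_ge0.
have pv : 0 < enorm v by rewrite lt_neqAle eq_sym v0 enorm_ge0.
have cs : \sum_(i < n) u i 0 * v i 0 <= enorm u * enorm v.
  have : 0 <= \sum_(i < n) (enorm v * u i 0 - enorm u * v i 0) ^+ 2.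
    by apply: sumr_ge0 => i _; exact: sqr_ge0.
  have -> : \sum_(i < n) (enorm v * u i 0 - enorm u * v i 0) ^+ 2 =
      2 * (enorm u * enorm v) *
        (enorm u * enorm v - \sum_(i < n) u i 0 * v i 0).
    transitivity (\sum_(i < n) (enorm v ^+ 2 * u i 0 ^+ 2 +
        enorm u ^+ 2 * v i 0 ^+ 2 -
        2 * (enorm u * enorm v) * (u i 0 * v i 0))).
      by apply: eq_bigr => i _; ring.
    rewrite !big_split/= sumrN -!mulr_sumr -!sqr_enorm; ring.
  by rewrite pmulr_rge0 ?subr_ge0// !mulr_gt0.
rewrite -(ler_pXn2r (n := 2))// ?nnegrE ?addr_ge0 ?enorm_ge0//.
rewrite sqr_enorm sqrrD !sqr_enorm.
under eq_bigr do rewrite mxE sqrrD.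
rewrite !big_split/= lerD2r lerD2l.
by rewrite mulr2n lerD.
Qed.

Lemma enormN v : enorm (- v) = enorm v.
Proof. by rewrite -scaleN1r enormZ normrN1 mul1r. Qed.

Lemma ler_enormB u v : enorm (u - v) <= enorm u + enorm v.
Proof. by rewrite -(enormN v) ler_enormD. Qed.

Lemma enorm_clip_le C v : 0 <= C -> enorm (clip C v) <= C.
Proof.
move=> C0; have [v0|v0] := eqVneq (enorm v) 0.
  by rewrite /clip (enorm_eq0 v0) scaler0 enorm0.
have pv : 0 < enorm v by rewrite lt_neqAle eq_sym v0 enorm_ge0.
rewrite enormZ ger0_norm ?le_min ?divr_ge0 ?enorm_ge0 ?ler01//.
by rewrite -ler_pdivlMr// ge_min lexx.
Qed.

(** Clipping acts along the ray of [v]: what it leaves over is zero or has norm [enorm v - C]. *)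
Lemma enorm_sub_clip C v z : 0 <= C -> enorm v <= z + C -> 0 <= z ->
  enorm (v - clip C v) <= z.
Proof.
move=> C0 vz z0; have [v0|v0] := eqVneq (enorm v) 0.
  by rewrite /clip (enorm_eq0 v0) scaler0 subr0 enorm0.
have pv : 0 < enorm v by rewrite lt_neqAle eq_sym v0 enorm_ge0.
rewrite -[X in X - _]scale1r -scalerBl enormZ ger0_norm; last first.
  by rewrite subr_ge0 ge_min lexx orbT.
rewrite mulrBl mul1r lerBlDr /Num.min; case: ifP => _.
  by rewrite divfK.
by rewrite mul1r lerDr.
Qed.

End euclidean_norm.

(** * Joint law of the scalar coordinates of the block noise *)

Section block_noise_law.
Context {R : realType} {k : nat} {r : 'I_k -> nat}.
Context {d : measure_display} {W : measurableType d} {P : probability W R}.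

(** A block, a time and a row. The range of the row depends on the block, hence the dependent
    sum. *)
Definition noise_index := {i : 'I_k & (nat * 'I_(r i))%type}.

Definition noise_coord (i : 'I_k) (t : nat) (j : 'I_(r i)) : noise_index :=
  Tagged (fun i => (nat * 'I_(r i))%type) (t, j).

Definition index_step (e : noise_index) : 'I_k * nat := (tag e, (tagged e).1).

Variables (sigma : 'I_k -> R) (xi : forall i : 'I_k, nat -> {RV P >-> 'cV[R]_(r i)}).
Hypothesis hxi : block_noise P sigma xi.

Definition noise_sample (w : W) : noise R noise_index :=
  fun e => xi (tag e) (tagged e).1 w (tagged e).2 0.

Lemma measurable_noise_sample : measurable_fun setT noise_sample.
Proof.
apply: measurable_noiseP => e.
exact: measurable_cV_app.
Qed.

HB.instance Definition _ :=
  isMeasurableFun.Build _ _ _ _ noise_sample measurable_noise_sample.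

(** [block_noise] factorizes in two layers, between the vectors and inside each of them. A scalar
    cylinder is first rewritten as an intersection of boxes, one for each vector that has a
    coordinate in [J]. *)
Lemma noise_sample_cylinder J B : uniq J -> (forall e, measurable (B e)) ->
  distribution P noise_sample (noise_cylinder J B) =
  (\prod_(e <- J) normal_prob 0 (sigma (tag e)) (B e))%E.
Proof.
(* Coordinates off [J] get the whole line, so that boxes constrain complete vectors; the extra
   factors equal 1. *)
move=> uJ mB; pose B' e := if e \in J then B e else setT.
have mB' e : measurable (B' e) by rewrite /B'; case: ifP.
pose J' := undup (map index_step J).
pose box (p : 'I_k * nat) : set 'cV[R]_(r p.1) :=
  [set v | forall j, B' (noise_coord p.2 j) (v j 0)].
have mbox p : measurable (box p).
  have -> : box p = \bigcap_(j in [set: 'I_(r p.1)])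
      (fun v : 'cV[R]_(r p.1) => v j 0) @^-1` B' (noise_coord p.2 j).
    by apply/seteqP; split=> v /= h j => [_|]; exact: h.
  apply: fin_bigcap_measurable => [|j _]; first exact: finite_finset.
  by rewrite -[X in measurable X]setTI; exact: measurable_cV_coord.
have PC : noise_sample @^-1` noise_cylinder J B =
    [set w | forall p, p \in J' -> box p (xi p.1 p.2 w)].
  apply/seteqP; split=> w /=.
    move=> h p _ j; rewrite /B'; case: ifPn => // eJ.
    exact: (h _ eJ).
  move=> h e eJ.
  have /h /(_ (tagged e).2) : index_step e \in J'.
    by rewrite mem_undup map_f.
  have -> : noise_coord (index_step e).2 (tagged e).2 = e.
    by case: e {eJ} => i [t j].
  by rewrite /B' eJ.
have := hxi.2 J' box (undup_uniq _) mbox.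
rewrite -PC => PCE; rewrite /distribution/pushforward.
rewrite -[LHS]fineK ?fin_num_measure//; last first.
  rewrite -[X in measurable X]setTI; apply: measurable_noise_sample => //.
  exact: measurable_noise_cylinder.
rewrite PCE.
pose F e := fine (normal_prob 0 (sigma (tag e)) (B' e)).
have N1 (i : 'I_k) : normal_prob 0 (sigma i) [set: R] = 1%E.
  exact: probability_setT.
have finN i A : measurable A -> normal_prob 0 (sigma i) A \is a fin_num.
  by move=> mA; exact: fin_num_measure.
have -> : (\prod_(e <- J) normal_prob 0 (sigma (tag e)) (B e))%E =
    (\prod_(e <- J) F e)%:E.
  rewrite -prodEFin; apply: eq_big_seq => e eJ.
  by rewrite /F /B' eJ fineK//; exact: (finN _ _ (mB e)).
congr EFin; transitivity (\prod_(p <- J') \prod_(j < r p.1) F (noise_coord p.2 j)).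
  apply: eq_bigr => p _.
  by apply: (hxi.1 p.1 p.2 (fun j => B' (noise_coord p.2 j))).
have -> : \prod_(p <- J') \prod_(j < r p.1) F (noise_coord p.2 j) =
    \prod_(e <- [seq noise_coord p.2 j | p <- J', j <- enum 'I_(r p.1)]) F e.
  rewrite big_allpairs_dep; apply: eq_bigr => p _.
  by rewrite big_enum.
(* [L] lists all coordinates of the vectors concerned; filtering it by [J] gives a permutation of
   [J]. *)
set L := [seq _ | _ <- _, _ <- _].
have uL : uniq L.
  apply: allpairs_uniq_dep; first exact: undup_uniq.
    by move=> p _; exact: enum_uniq.
  pose g (e : noise_index) :=
    Tagged (fun p : 'I_k * nat => 'I_(r p.1)) (i := index_step e) (tagged e).2.
  by apply: (can_in_inj (g := g)) => -[[i t] j].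
rewrite (bigID (mem J))/= [X in _ * X]big1 ?mulr1; last first.
  by move=> e eJ; rewrite /F /B' (negbTE eJ) N1.
rewrite -big_filter; apply: perm_big; apply: uniq_perm => //.
  exact: filter_uniq.
move=> e; rewrite mem_filter /=; case: (boolP (e \in J)) => //= eJ.
apply/allpairsPdep; exists (index_step e), (tagged e).2; split.
- by rewrite mem_undup map_f.
- by rewrite mem_enum.
- by case: e {eJ} => i [t j].
Qed.

Lemma renyi_shift_noise_sample (s : noise_index -> noise R noise_index -> R)
    (E : seq noise_index) (q delta B : R) (S : set (noise R noise_index)) :
  (forall i, 0 < sigma i) ->
  (forall e, measurable_fun setT (s e)) -> predictable s E ->
  1 < q -> 0 < delta ->
  (forall v, \sum_(e <- E) q * s e v ^+ 2 / (2 * sigma (tag e) ^+ 2) <= B) ->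
  measurable S ->
  (P [set w | S (shift_noise s E (noise_sample w))] <=
    (expR (B + ln delta^-1 / (q - 1)))%:E * P [set w | S (noise_sample w)] +
    delta%:E)%E.
Proof.
move=> sigma0 ms ps q1 d0 sB mS.
have sigma_neq0 (e : noise_index) : sigma (tag e) != 0 by rewrite gt_eqF.
exact: (renyi_shift_noise sigma_neq0 noise_sample_cylinder ms ps q1 d0 sB mS).
Qed.

End block_noise_law.

(** * Shift radii, their energy, and the calibration of the noise *)

Section shift_schedule.
Context {R : realType}.

(* The Renyi cost, for unit noise and up to the factor q / 2, of contracting to 0
   in n steps the difference of two iterates started zeta apart, when each step
   multiplies it by c and adds at most b to it. *)
Definition shift_energy (c b zeta : R) (n : nat) : R :=
  (1 - c ^+ 2) * (c ^+ n * zeta + b / (1 - c) * (1 - c ^+ n)) ^+ 2 /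
  (1 - c ^+ n ^+ 2).

(* The shifts [a t], proportional to [c ^- t], minimize [sum_t a t ^+ 2] under the
   constraint that the bound [z] on the difference of the iterates ends at 0. *)
Lemma shift_schedule (c b zeta : R) (n : nat) :
  0 < c < 1 -> 0 <= b -> 0 <= zeta -> (0 < n)%N ->
  exists a z : nat -> R,
    [/\ z 0%N = zeta /\ z n = 0,
        forall t, 0 <= a t,
        forall t, (t <= n)%N -> 0 <= z t,
        forall t, c * z t + b = z t.+1 + a t &
        \sum_(t < n) a t ^+ 2 = shift_energy c b zeta n].
Proof.
move=> /andP[c0 c1] b0 zeta0 n0.
(* [B] is the fixed point of [x |-> c * x + b], and [K] is the value that makes the last bound [z n]
   vanish. *)
pose p := c ^+ n; pose B := b / (1 - c).
pose K := (p * zeta + B * (1 - p)) / (1 - p ^+ 2).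
have c_neq0 : c != 0 by rewrite gt_eqF.
have p0 : 0 < p by rewrite exprn_gt0.
have p1 : p < 1 by rewrite exprn_ilt1 ?ltW// -lt0n.
have cX_neq0 t : c ^+ t != 0 by rewrite gt_eqF// exprn_gt0.
have c1' : 0 < 1 - c by rewrite subr_gt0.
have p1' : 0 < 1 - p by rewrite subr_gt0.
have c2 : 0 < 1 - c ^+ 2 by nra.
have p2 : 0 < 1 - p ^+ 2 by nra.
have B0 : 0 <= B by rewrite divr_ge0// ltW.
have K0 : 0 <= K.
  apply: divr_ge0; last exact: ltW.
  by apply: addr_ge0; apply: mulr_ge0 => //; exact: ltW.
have bE : b = B * (1 - c) by rewrite /B divfK// gt_eqF.
exists (fun t => K * (1 - c ^+ 2) * p / c ^+ t.+1).
exists (fun t => c ^+ t * zeta + B * (1 - c ^+ t) - K * p * (c ^- t - c ^+ t)).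
split.
- split; first by rewrite expr0 invr1 subrr; ring.
  by rewrite -/p /K; field; rewrite !gt_eqF.
- move=> t; apply: divr_ge0; last by apply: exprn_ge0; exact: ltW.
  by apply: mulr_ge0; [apply: mulr_ge0 => //; exact: ltW|exact: ltW].
- move=> t tn; set u := c ^+ t.
  have pu : p <= u by rewrite /p /u ler_wiXn2l ?ltW.
  have u1 : u <= 1 by rewrite exprn_ile1 ?ltW.
  have u0 : 0 < u by rewrite exprn_gt0.
  (* A factorization into terms that are nonnegative because [p <= u <= 1]. *)
  have -> : u * zeta + B * (1 - u) - K * p * (u^-1 - u) =
      (u - p) / ((1 - p) * u) *
      ((u - p) * (zeta / (1 - p)) +
       (1 - u) * ((2 * p * zeta + B * (1 - p) ^+ 2) / (1 - p ^+ 2))).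
    by rewrite /K; field; rewrite !gt_eqF.
  have zp : 0 <= zeta / (1 - p) by apply: divr_ge0 => //; exact: ltW.
  have zB : 0 <= (2 * p * zeta + B * (1 - p) ^+ 2) / (1 - p ^+ 2).
    apply: divr_ge0; last exact: ltW.
    apply: addr_ge0; last by apply: mulr_ge0 => //; exact: sqr_ge0.
    by apply: mulr_ge0 => //; apply: mulr_ge0 => //; exact: ltW.
  apply: mulr_ge0.
    by apply: divr_ge0; [rewrite subr_ge0|apply: mulr_ge0; exact: ltW].
  by rewrite addr_ge0// mulr_ge0// subr_ge0.
- by move=> t; rewrite bE !exprS; field; rewrite c_neq0 cX_neq0.
- have H m : \sum_(t < m) (K * (1 - c ^+ 2) * p / c ^+ t.+1) ^+ 2 =
      K ^+ 2 * (1 - c ^+ 2) * p ^+ 2 * (c ^- m ^+ 2 - 1).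
    elim: m => [|m ih]; first by rewrite big_ord0 expr0 invr1 expr1n subrr mulr0.
    rewrite big_ord_recr/= ih !exprS; field.
    by rewrite c_neq0 cX_neq0.
  rewrite H -/p /shift_energy -/p -/B /K; field.
  by rewrite !gt_eqF.
Qed.

(** The energy tends to [(1 - c ^+ 2) * (b / (1 - c)) ^+ 2] as [n] grows, and the strict inequality
    leaves room for the terms in [c ^+ n]. *)
Lemma shift_energy_lt (c b zeta M : R) :
  0 < c < 1 -> 0 <= b -> 0 <= zeta ->
  (1 - c ^+ 2) * (b / (1 - c)) ^+ 2 < M ->
  exists N, forall n, (N <= n)%N -> (0 < n)%N /\ shift_energy c b zeta n <= M.
Proof.
move=> /andP[c0 c1] b0 zeta0; set B := b / (1 - c) => BM.
have B0 : 0 <= B by rewrite divr_ge0// subr_ge0 ltW.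
have c2 : 0 < 1 - c ^+ 2 by nra.
have M0 : 0 < M by apply: le_lt_trans BM; rewrite mulr_ge0 ?sqr_ge0 ?ltW.
(* With [p = c ^+ n], [D] collects the coefficients of [p]: those of the squared numerator, and [M]
   from [M * p ^+ 2 <= M * p]. The bound holds once [p < eta]. *)
pose D := (1 - c ^+ 2) * (2 * B * zeta + zeta ^+ 2) + M.
have D0 : 0 < D.
  apply: ltr_wpDl => //; apply: mulr_ge0; first exact: ltW.
  apply: addr_ge0; last exact: sqr_ge0.
  by apply: mulr_ge0 => //; exact: mulr_ge0.
pose eta := (M - (1 - c ^+ 2) * B ^+ 2) / D.
have eta0 : 0 < eta by rewrite divr_gt0 ?subr_gt0.
have /cvgrPdist_lt /(_ _ eta0) [N _ HN] : (fun n => c ^+ n) @ \oo --> (0 : R).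
  by apply: cvg_expr; rewrite gtr0_norm.
(* The successor also excludes [n = 0], where the energy divides by 0. *)
exists N.+1 => n Nn; have n0 : (0 < n)%N by exact: leq_trans Nn.
split=> //; have := HN n (ltnW Nn); rewrite sub0r normrN.
set p := c ^+ n; have p0 : 0 < p by rewrite exprn_gt0.
have p1 : p < 1 by rewrite exprn_ilt1 ?ltW// -lt0n.
rewrite (gtr0_norm p0) /eta ltr_pdivlMr// => pD.
have p2 : 0 < 1 - p ^+ 2 by nra.
rewrite /shift_energy -/p -/B ler_pdivrMr//.
have h1 : (p * zeta + B * (1 - p)) ^+ 2 <= (B + p * zeta) ^+ 2.
  have pz : 0 <= p * zeta by apply: mulr_ge0 => //; exact: ltW.
  have Bp : 0 <= B * (1 - p) by apply: mulr_ge0 => //; rewrite subr_ge0 ltW.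
  by rewrite ler_pXn2r ?nnegrE ?addr_ge0//; nra.
apply: (@le_trans _ _ ((1 - c ^+ 2) * (B + p * zeta) ^+ 2)).
  by rewrite ler_pM2l.
have h2 : (B + p * zeta) ^+ 2 <= B ^+ 2 + (2 * B * zeta + zeta ^+ 2) * p.
  have : p ^+ 2 <= p by nra.
  have : 0 <= zeta ^+ 2 by exact: sqr_ge0.
  nra.
apply: (@le_trans _ _
  ((1 - c ^+ 2) * (B ^+ 2 + (2 * B * zeta + zeta ^+ 2) * p))).
  by rewrite ler_pM2l.
have : M * p ^+ 2 <= M * p by rewrite ler_pM2l//; nra.
move: pD; rewrite /D; lra.
Qed.

Lemma exp_step_number (c u : R) (n : nat) : 0 < c < 1 -> 0 < u < 1 ->
  n%:R = ln (1 - u) / ln c -> c ^+ n = 1 - u.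
Proof.
move=> /andP[c0 c1] /andP[u0 u1] nE.
have lnc : ln c != 0 by rewrite lt_eqF// ln_lt0// c0.
have u1' : 0 < 1 - u by rewrite subr_gt0.
by rewrite -[c in c ^+ n]lnK ?posrE// -expRM_natl nE divfK// lnK.
Qed.

(** Let [u = lambda * C0 / C1]. If [u < 1], the prescribed number of steps gives
    [(1 - gamma * lambda) ^+ n = 1 - u], and the cost is [epsR] times the ratio of the noise
    threshold to [sigma ^+ 2]. If [1 <= u], the strict noise condition is that of [shift_energy_lt],
    which provides [Tmin]. *)
Lemma calibration_steps :
  exists Tmin : R -> R -> R -> R -> R -> R -> R -> nat,
  forall gamma lambda C0 C1 q epsR sigma n,
    0 < gamma -> 0 <= lambda -> gamma * lambda < 1 -> 0 < C1 -> 1 < q ->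
    0 < epsR -> 0 < sigma ->
    calibrated Tmin gamma lambda C0 C1 q epsR sigma n ->
    [/\ 0 < C0, 0 < gamma * lambda, (0 < n)%N &
      q / (2 * sigma ^+ 2) *
        shift_energy (1 - gamma * lambda) (2 * gamma * C1) (2 * C0) n <= epsR].
Proof.
have E2 (gamma lambda C0 C1 q epsR sigma : R) : exists N, 0 < gamma ->
    0 < lambda -> gamma * lambda < 1 -> 0 < C0 -> 0 < C1 -> 1 < q ->
    0 < epsR -> 0 < sigma ->
    gamma * (2 - gamma * lambda) * (2 * q / epsR) * (C1 ^+ 2 / lambda) <
      sigma ^+ 2 ->
    forall n, (N <= n)%N -> (0 < n)%N /\ q / (2 * sigma ^+ 2) *
      shift_energy (1 - gamma * lambda) (2 * gamma * C1) (2 * C0) n <= epsR.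
  pose M := epsR / (q / (2 * sigma ^+ 2)).
  pose c := 1 - gamma * lambda; pose b := 2 * gamma * C1.
  (* [Tmin] is a total function, so a bound is needed for all arguments: 0 serves where the
     conditions of [shift_energy_lt] fail, which contradicts the hypotheses. *)
  have [BM|] := pselect [/\ 0 < c < 1, 0 <= b, 0 <= 2 * C0 &
    (1 - c ^+ 2) * (b / (1 - c)) ^+ 2 < M]; last first.
    move=> nBM; exists 0%N => g0 l0 gl C00 C10 q1 e0 s0 h; exfalso; apply: nBM.
    split; [by apply/andP; split; rewrite /c; nra|by rewrite !mulr_ge0 ?ltW|
      by rewrite mulr_ge0 ?ltW|].
    have q0 : 0 < q by lra.
    (* Multiplied by [2 * epsR / q], the noise condition becomes the condition on the limit of the
       energy. *)
    rewrite [ltLHS](_ : _ = gamma * (2 - gamma * lambda) * (2 * q / epsR) *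
        (C1 ^+ 2 / lambda) * (2 * epsR / q)); last first.
      by rewrite /c /b; field; rewrite !gt_eqF//=; nra.
    rewrite (_ : M = sigma ^+ 2 * (2 * epsR / q)); last first.
      by rewrite /M; field; rewrite !gt_eqF.
    by rewrite ltr_pM2r// divr_gt0// mulr_gt0.
  have [BM1 BM2 BM3 BM4] := BM.
  have [N HN] := shift_energy_lt BM1 BM2 BM3 BM4.
  exists N => g0 l0 gl C00 C10 q1 e0 s0 _ n Nn; have [n0 nM] := HN n Nn.
  by split=> //; rewrite mulrC -ler_pdivlMr// divr_gt0 ?mulr_gt0 ?exprn_gt0//; lra.
exists (fun gamma lambda C0 C1 q epsR sigma =>
  sval (cid (E2 gamma lambda C0 C1 q epsR sigma))).
move=> gamma lambda C0 C1 q epsR sigma n g0 l0 gl C10 q1 e0 s0.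
have q0 : 0 < q by lra.
case=> [[/andP[u0 u1] hs hT]|[u1 hs hT]]; last first.
  have l0' : 0 < lambda.
    rewrite lt_neqAle l0 andbT; apply/eqP => l0'.
    by move: u1; rewrite -l0' !mul0r; lra.
  have C00 : 0 < C0.
    by move: u1; rewrite ler_pdivlMr// mul1r; nra.
  move: hT; case: cid => /= N HN Nn.
  have [n0 ?] := HN g0 l0' gl C00 C10 q1 e0 s0 hs n Nn.
  by split=> //; rewrite mulr_gt0.
have lC0 : 0 < lambda * C0 by move: u0; rewrite pmulr_lgt0 ?invr_gt0.
have l0' : 0 < lambda.
  rewrite lt_neqAle l0 andbT; apply/eqP => l0'.
  by move: lC0; rewrite -l0' mul0r ltxx.
have C00 : 0 < C0 by move: lC0; rewrite pmulr_rgt0.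
have gl0 : 0 < gamma * lambda by rewrite mulr_gt0.
have cn : (1 - gamma * lambda) ^+ n = 1 - lambda * C0 / C1.
  by apply: exp_step_number => //; apply/andP; split=> //; lra.
have n0 : (0 < n)%N.
  rewrite lt0n; apply/eqP => n0; move: cn; rewrite n0 expr0; lra.
split=> //; rewrite /shift_energy cn.
move: hs; set u := lambda * C0 / C1 => hs.
have -> : q / (2 * sigma ^+ 2) * ((1 - (1 - gamma * lambda) ^+ 2) *
    ((1 - u) * (2 * C0) + 2 * gamma * C1 / (1 - (1 - gamma * lambda)) *
      (1 - (1 - u))) ^+ 2 / (1 - (1 - u) ^+ 2)) =
    gamma * (2 - gamma * lambda) * (2 * q / epsR) * (2 - u) * C0 * C1 *
      epsR / sigma ^+ 2.
  have C0E : C0 = u * C1 / lambda by rewrite /u; field; rewrite !gt_eqF.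
  rewrite C0E; field; rewrite !gt_eqF//=; first nra.
  by move: u0 u1; rewrite -/u; nra.
by rewrite ler_pdivrMr ?exprn_gt0// [leRHS]mulrC ler_pM2r.
Qed.

End shift_schedule.

(** * Orthogonal decomposition of the parameters into blocks *)

Section orthogonal_blocks.
Context {R : realType} {d k : nat} {r : 'I_k -> nat}.
Variable A : forall i : 'I_k, 'M[R]_(d, r i).
Hypothesis hr : (\sum_(i < k) r i)%N = d.
Hypothesis hA : (\mxrow_(i < k) A i)^T *m (\mxrow_(i < k) A i) = 1%:M.

Lemma mul_tr_block i : (A i)^T *m A i = 1%:M.
Proof.
move: hA; rewrite tr_mxrow mul_mxcol_mxrow -mxdiagZ /mxdiag.
move=> /eq_mxblockP /(_ i i).
by rewrite eqxx conform_mx_id.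
Qed.

Lemma mul_tr_block_neq i j : i != j -> (A i)^T *m A j = 0.
Proof.
move=> /negbTE ij; move: hA; rewrite tr_mxrow mul_mxcol_mxrow -mxdiagZ /mxdiag.
by move=> /eq_mxblockP /(_ i j); rewrite ij.
Qed.

(** The concatenated matrix is square because [r] sums to [d], so its left inverse is a right
    inverse. Eliminating [hr] makes its two dimensions the same expression. *)
Lemma sum_mul_block_tr : \sum_(i < k) A i *m (A i)^T = 1%:M.
Proof.
rewrite -mul_mxrow_mxcol -tr_mxrow.
move: (\mxrow_i A i) hA => M; case: _ / hr in M * => MM.
exact: mulmx1C.
Qed.

Lemma sum_block (W : 'cV[R]_d) : \sum_(i < k) A i *m block A i W = W.
Proof.
rewrite -[RHS]mul1mx -sum_mul_block_tr mulmx_suml.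
by apply: eq_bigr => i _; rewrite mulmxA.
Qed.

Lemma block_inj (X Y : 'cV[R]_d) :
  (forall i, block A i X = block A i Y) -> X = Y.
Proof.
by move=> XY; rewrite -(sum_block X) -(sum_block Y); under eq_bigr do rewrite XY.
Qed.

Lemma blockB i (X Y : 'cV[R]_d) :
  block A i (X - Y) = block A i X - block A i Y.
Proof. exact: mulmxBr. Qed.

Lemma block_set_block i W b : block A i (set_block A W b) = b.
Proof.
rewrite /block /set_block mulmxDr mulmxA mul_tr_block mul1mx mulmx_sumr.
rewrite big1 ?addr0// => j ji.
by rewrite mulmxA mul_tr_block_neq ?mul0mx// eq_sym.
Qed.

Lemma block_set_block_neq i j W (b : 'cV[R]_(r i)) : j != i ->
  block A j (set_block A W b) = block A j W.
Proof.
move=> ji; rewrite -[in RHS](sum_block W) (bigD1 i)//= /set_block /block.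
by rewrite !mulmxDr mulmxA mul_tr_block_neq// mul0mx mulmxA mul_tr_block_neq//
  mul0mx.
Qed.

Lemma set_block_id i W : set_block A W (block A i W) = W.
Proof. by rewrite -[RHS]sum_block (bigD1 i). Qed.

Lemma set_block_set_block i W (b b' : 'cV[R]_(r i)) :
  set_block A (set_block A W b) b' = set_block A W b'.
Proof.
apply: block_inj => j; have [->|ji] := eqVneq j i.
  by rewrite !block_set_block.
by rewrite !block_set_block_neq.
Qed.

(** Parseval's identity: the squared norms of the blocks sum to that of [v]. *)
Lemma enorm_block_le i (v : 'cV[R]_d) : enorm (block A i v) <= enorm v.
Proof.
have sqrE n (u : 'cV[R]_n) : enorm u ^+ 2 = (u^T *m u) 0 0.
  by rewrite sqr_enorm mxE; apply: eq_bigr => j _; rewrite mxE expr2.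
have vE : enorm v ^+ 2 = \sum_(j < k) enorm (block A j v) ^+ 2.
  rewrite sqrE -{2}(sum_block v) mulmx_sumr summxE; apply: eq_bigr => j _.
  by rewrite sqrE /block trmx_mul trmxK mulmxA.
rewrite -(ler_pXn2r (n := 2))// ?nnegrE ?enorm_ge0// vE (bigD1 i)//= lerDl.
by apply: sumr_ge0 => j _; exact: sqr_ge0.
Qed.

Lemma measurable_block dT (T : measurableType dT) i (f : T -> 'cV[R]_d) :
  measurable_fun setT f -> measurable_fun setT (fun w => block A i (f w)).
Proof. exact: measurable_mulmx. Qed.

Lemma measurable_set_block dT (T : measurableType dT) i (f : T -> 'cV[R]_d)
    (g : T -> 'cV[R]_(r i)) : measurable_fun setT f -> measurable_fun setT g ->
  measurable_fun setT (fun w => set_block A (f w) (g w)).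
Proof.
move=> mf mg; have E w : set_block A (f w) (g w) =
    f w + A i *m (g w - block A i (f w)).
  rewrite mulmxBr -[X in _ = X + _](sum_block (f w)) (bigD1 i)//=.
  by rewrite [RHS]addrC addrA subrK.
under eq_fun do rewrite E.
apply: measurable_cVD => //; apply: measurable_mulmx; apply: measurable_cVB => //.
exact: measurable_block.
Qed.

End orthogonal_blocks.

(** * Coupled trajectories and the noise shift between them *)

Section coupling.
Context {R : realType} {d k : nat} {r : 'I_k -> nat}.
Variable A : forall i : 'I_k, 'M[R]_(d, r i).
Hypothesis hr : (\sum_(i < k) r i)%N = d.
Hypothesis hA : (\mxrow_(i < k) A i)^T *m (\mxrow_(i < k) A i) = 1%:M.
Variable F : forall i : 'I_k, nat -> 'cV[R]_d -> 'cV[R]_(r i).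
Hypothesis mF : forall i t, measurable_fun setT (F i t).
Variable a : 'I_k -> nat -> R.
Local Notation noise := (noise R (@noise_index k r)).
Local Notation V := 'cV[R]_d.

(** Step [t] of [noisy_finetuning] adds the noise of index [t.+1]; the predecessors taken below
    recover the step from a noise coordinate. *)
Definition noise_vec (z : noise) i t : 'cV[R]_(r i) :=
  \col_j z (noise_coord t.+1 j).

Definition block_step (z : noise) (W : V) (p : 'I_k * nat) : V :=
  set_block A W (F p.1 p.2 W + noise_vec z p.1 p.2).

Definition correction (st : V * V) i t : 'cV[R]_(r i) :=
  clip (a i t) (F i t st.1 - F i t st.2).

(* Two trajectories driven by the same noise, the second of which is moreover
   pulled towards the first one. *)
Definition coupled_step (z : noise) (st : V * V) (p : 'I_k * nat) : V * V :=
  (block_step z st.1 p,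
   set_block A st.2
     (F p.1 p.2 st.2 + noise_vec z p.1 p.2 + correction st p.1 p.2)).

Lemma coupled_step_fst z st L :
  (foldl (coupled_step z) st L).1 = foldl (block_step z) st.1 L.
Proof. by elim: L st => //= p L ih st; rewrite ih. Qed.

Section measurability.
Context {dT : measure_display} {T : measurableType dT}.
Variable z : T -> noise.
Hypothesis mz : measurable_fun setT z.

Lemma measurable_noise_vec i t : measurable_fun setT (fun w => noise_vec (z w) i t).
Proof.
apply: measurable_cVP => j; under eq_fun do rewrite mxE.
exact: (measurableT_comp (measurable_noise_coord _) mz).
Qed.

Lemma measurable_block_steps (f : T -> V) L : measurable_fun setT f ->
  measurable_fun setT (fun w => foldl (block_step (z w)) (f w) L).
Proof.
elim: L f => //= p L ih f mf; apply: ih; apply: measurable_set_block => //.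
apply: measurable_cVD; last exact: measurable_noise_vec.
exact: (measurableT_comp (@mF p.1 p.2) mf).
Qed.

Lemma measurable_correction (f g : T -> V) i t :
  measurable_fun setT f -> measurable_fun setT g ->
  measurable_fun setT (fun w => correction (f w, g w) i t).
Proof.
move=> mf mg; apply: measurable_clip; apply: measurable_cVB.
  exact: (measurableT_comp (@mF i t) mf).
exact: (measurableT_comp (@mF i t) mg).
Qed.

Lemma measurable_coupled_steps_snd (f g : T -> V) L :
  measurable_fun setT f -> measurable_fun setT g ->
  measurable_fun setT (fun w => (foldl (coupled_step (z w)) (f w, g w) L).2).
Proof.
elim: L f g => //= p L ih f g mf mg; apply: ih.
  exact: (@measurable_block_steps f [:: p]).
apply: measurable_set_block => //; apply: measurable_cVD; last first.
  exact: measurable_correction.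
apply: measurable_cVD; last exact: measurable_noise_vec.
exact: (measurableT_comp (@mF p.1 p.2) mg).
Qed.

End measurability.

Section coupling_shift.
Variables (st0 : V * V) (L : seq ('I_k * nat)).
Hypothesis uL : uniq L.
Local Notation index_step1 e := (tag e, (tagged e).1.-1).

Definition state_before z p := foldl (coupled_step z) st0 (take (index p L) L).

(** Evaluated on the state recomputed from the noise of earlier steps, the correction becomes a
    function of the noise alone, as a Girsanov shift has to be. *)
Definition coupling_shift (e : @noise_index k r) (z : noise) : R :=
  correction (state_before z (index_step1 e)) (tag e) (tagged e).1.-1
    (tagged e).2 0.

Definition noise_coords (L : seq ('I_k * nat)) : seq (@noise_index k r) :=
  [seq noise_coord p.2.+1 j | p <- L, j <- enum 'I_(r p.1)].

Lemma measurable_correction_before p i t :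
  measurable_fun setT (fun z => correction (state_before z p) i t).
Proof.
have E z : state_before z p =
    (foldl (block_step z) st0.1 (take (index p L) L),
     (foldl (coupled_step z) (st0.1, st0.2) (take (index p L) L)).2).
  by rewrite -coupled_step_fst -surjective_pairing -surjective_pairing.
rewrite (_ : (fun z => _) = fun z => correction
    (foldl (block_step z) st0.1 (take (index p L) L),
     (foldl (coupled_step z) (st0.1, st0.2) (take (index p L) L)).2) i t).
  apply: measurable_correction; first exact: measurable_block_steps.
  exact: measurable_coupled_steps_snd.
by apply/funext => z; rewrite E.
Qed.

Lemma measurable_coupling_shift e : measurable_fun setT (coupling_shift e).
Proof. by apply: measurable_cV_app; exact: measurable_correction_before. Qed.

Lemma coupled_steps_update z p (j : 'I_(r p.1)) x st s : p \notin s ->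
  foldl (coupled_step (update (noise_coord p.2.+1 j) z x)) st s =
  foldl (coupled_step z) st s.
Proof.
elim: s st => //= p' s ih st; rewrite inE negb_or => /andP[pp' ps].
rewrite ih//; congr foldl.
have E : noise_vec (update (noise_coord p.2.+1 j) z x) p'.1 p'.2 =
    noise_vec z p'.1 p'.2.
  apply/colP => j'; rewrite !mxE /update ifN//; apply: contra pp' => /eqP.
  move=> /(congr1 (@index_step k r)) /eqP; rewrite /index_step/=.
  rewrite xpair_eqE eqSS => /andP[/eqP e1 /eqP e2].
  by rewrite -pair_eqE /pair_eq/= e1 e2 !eqxx.
by rewrite /coupled_step /block_step E.
Qed.

(** The state before a step reads strictly earlier noises, so the noise of that same step may change
    too: hence the non-strict inequality. *)
Lemma coupling_shift_update e z p (j : 'I_(r p.1)) x :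
  (index (index_step1 e) L <= index p L)%N -> p \in L ->
  coupling_shift e (update (noise_coord p.2.+1 j) z x) = coupling_shift e z.
Proof.
move=> ep pL; rewrite /coupling_shift /state_before coupled_steps_update//.
by rewrite in_take// -leqNgt.
Qed.

Lemma noise_coordsP L' e : e \in noise_coords L' -> index_step1 e \in L'.
Proof. by move=> /allpairsPdep[[i t] [j [pL _ ->]]]. Qed.

Lemma uniq_noise_coords L' : uniq L' -> uniq (noise_coords L').
Proof.
move=> uL'; apply: allpairs_uniq_dep => //; first by move=> p _; exact: enum_uniq.
pose g (e : @noise_index k r) :=
  Tagged (fun p : 'I_k * nat => 'I_(r p.1)) (i := index_step1 e) (tagged e).2.
by apply: (can_in_inj (g := g)) => -[[i t] j].
Qed.

(** Steps are listed from the latest to the earliest. Inside a step the order of the coordinates is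
    immaterial, since no shift of that step reads any of them. *)
Lemma predictable_coupling_shift :
  predictable coupling_shift (noise_coords (rev L)).
Proof.
suff H n : (n <= size L)%N ->
    predictable coupling_shift (noise_coords (rev (take n L))).
  by rewrite -[in rev L](take_size L); exact: H.
elim: n => [|n ih] nL; first by rewrite take0.
have [p0 _] : exists p0 : 'I_k * nat, True.
  by case: L nL => // p0 *; exists p0.
rewrite (take_nth p0 nL) rev_rcons; set p := nth p0 L n.
have pL : p \in L by exact: mem_nth.
have pn : index p L = n by exact: index_uniq.
have : uniq (noise_coords (p :: rev (take n L))).
  apply: uniq_noise_coords; rewrite /= rev_uniq take_uniq// andbT mem_rev.
  by rewrite in_take// pn ltnn.
have before e : e \in noise_coords (rev (take n L)) ->
    (index (index_step1 e) L <= index p L)%N.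
  move=> /noise_coordsP; rewrite mem_rev => eL.
  by have := eL; rewrite in_take ?(mem_take eL)// pn => /ltnW.
rewrite /noise_coords allpairs_cons -/(noise_coords _).
(* Inner induction on the coordinates of step [p], with the earlier steps as base case. *)
elim: (enum 'I_(r p.1)) => [|j js jh]; first by move=> _; exact: (ih (ltnW nL)).
rewrite /= => /andP[jjs /[dup] ujs /jh pjs]; split=> // e z x eE.
apply: coupling_shift_update => //.
move: eE; rewrite inE mem_cat => /orP[/eqP->|/orP[/mapP[j' _ ->]|/before//]] /=.
  by rewrite -surjective_pairing.
by rewrite -surjective_pairing.
Qed.

(** A correction added after the noise can be counted as part of the noise, so pulling the second
    trajectory amounts to running the plain algorithm on shifted noise. *)
Lemma shifted_block_steps z :
  foldl (block_step (shift_noise coupling_shift (noise_coords (rev L)) z))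
    st0.2 L = (foldl (coupled_step z) st0 L).2.
Proof.
suff H n : (n <= size L)%N ->
    foldl (block_step (shift_noise coupling_shift (noise_coords (rev L)) z))
      st0.2 (take n L) = (foldl (coupled_step z) st0 (take n L)).2.
  by have := H _ (leqnn _); rewrite take_size.
elim: n => [|n ih] nL; first by rewrite take0.
have [p0 _] : exists p0 : 'I_k * nat, True.
  by case: L nL => // p0 *; exists p0.
rewrite (take_nth p0 nL); set p := nth p0 L n.
have pL : p \in L by exact: mem_nth.
have pn : index p L = n by exact: index_uniq.
rewrite !foldl_rcons (ih (ltnW nL)) [LHS]/block_step /=.
congr (set_block _ _ _).
rewrite -addrA; congr (_ + _); apply/colP => j.
rewrite [LHS]mxE [RHS]mxE [X in _ = X + _]mxE /shift_noise.
rewrite ifT; last first.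
  apply/allpairsPdep; exists p, j; split => //; first by rewrite mem_rev.
  by rewrite mem_enum.
by rewrite /coupling_shift /state_before /= -surjective_pairing pn.
Qed.

(** The squared shifts of the coordinates of one step add up to the squared norm of a correction,
    which is clipped to radius [a]. *)
Lemma energy_coupling_shift (c : 'I_k -> R) z :
  (forall i, 0 <= c i) -> (forall i t, 0 <= a i t) ->
  \sum_(e <- noise_coords (rev L)) c (tag e) * coupling_shift e z ^+ 2 <=
  \sum_(p <- L) c p.1 * a p.1 p.2 ^+ 2.
Proof.
move=> c0 a0; rewrite big_allpairs_dep -[leRHS]big_rev/=.
apply: ler_sum => p _; rewrite big_enum/= -mulr_sumr ler_wpM2l//.
rewrite [leLHS](_ : _ =
    enorm (correction (state_before z p) p.1 p.2) ^+ 2); last first.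
  rewrite sqr_enorm; apply: eq_bigr => j _.
  by rewrite /coupling_shift /= -surjective_pairing.
by rewrite ler_pXn2r ?nnegrE ?enorm_ge0// enorm_clip_le.
Qed.

End coupling_shift.
End coupling.

(** * Vanishing of the gap between coupled trajectories *)

Section contraction.
Context {R : realType} {d k : nat} {r : 'I_k -> nat}.
Variable A : forall i : 'I_k, 'M[R]_(d, r i).
Hypothesis hr : (\sum_(i < k) r i)%N = d.
Hypothesis hA : (\mxrow_(i < k) A i)^T *m (\mxrow_(i < k) A i) = 1%:M.
Variable F : forall i : 'I_k, nat -> 'cV[R]_d -> 'cV[R]_(r i).
Variables (c b : R) (a z : 'I_k -> nat -> R) (T : 'I_k -> nat).
Hypothesis c0 : 0 <= c.
Hypothesis hF : forall i t X Y, enorm (F i t X - F i t Y) <=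
  c * enorm (block A i X - block A i Y) + b.
Hypothesis a0 : forall i t, 0 <= a i t.
Hypothesis z0 : forall i t, (t <= T i)%N -> 0 <= z i t.
Hypothesis zS : forall i t, c * z i t + b = z i t.+1 + a i t.
Hypothesis zT : forall i, z i (T i) = 0.
Local Notation V := 'cV[R]_d.
Variable xi : noise R (@noise_index k r).

Let gap i (st : V * V) := block A i st.1 - block A i st.2.

(** The update brings a gap of at most [z i t] to at most [c * z i t + b = z i t.+1 + a i t], and
    the correction removes [a i t]. By [hF] the other blocks do not enter the bound. *)
Lemma coupled_block_steps i n (st : V * V) : (n <= T i)%N ->
  enorm (gap i st) <= z i 0 ->
  let st' := foldl (coupled_step A F a xi) st [seq (i, t) | t <- iota 0 n] in
  enorm (gap i st') <= z i n /\ forall j, j != i -> gap j st' = gap j st.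
Proof.
move=> + st0; elim: n => [|n ih] nT //.
have iE : iota 0 n.+1 = rcons (iota 0 n) n by rewrite -cats1 -addn1 iotaD.
rewrite iE map_rcons foldl_rcons; have [] := ih (ltnW nT).
set st' := foldl _ _ _ => stn stj; split; last first.
  by move=> j ji; rewrite -stj// /gap/= !block_set_block_neq.
rewrite /gap/= !block_set_block//.
set u := F _ _ _; set nv := noise_vec _ _ _; set v := F _ _ _.
(* The noise common to both trajectories cancels. *)
rewrite (_ : _ - _ = (u - v) - clip (a i n) (u - v)); last first.
  by rewrite /correction -/u -/v opprD addrA (opprD v) addrACA subrr addr0.
apply: enorm_sub_clip; [exact: a0| |exact: z0].
by rewrite -zS; apply: le_trans (hF _ _ _ _) _; rewrite lerD2r ler_wpM2l.
Qed.

Definition steps (s : seq 'I_k) : seq ('I_k * nat) :=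
  [seq (i, t) | i <- s, t <- iota 0 (T i)].

(** Steps of one block preserve the gaps of the others: a block still has its initial gap when its
    turn comes, and keeps the gap 0 afterwards because [s] has no repetition. *)
Lemma coupled_blocks (s : seq 'I_k) (st : V * V) : uniq s ->
  (forall i, i \in s -> enorm (gap i st) <= z i 0) ->
  forall i, gap i (foldl (coupled_step A F a xi) st (steps s)) =
    if i \in s then 0 else gap i st.
Proof.
elim: s st => [|j s ih] st //= /andP[js us] hs i.
rewrite /steps allpairs_cons -/(steps _) foldl_cat.
have [] := coupled_block_steps (leqnn (T j)) (hs _ (mem_head _ _)).
set st' := foldl _ st _ => stj sti.
have hs' l : l \in s -> enorm (gap l st') <= z l 0.
  move=> ls; rewrite sti ?hs ?inE ?ls ?orbT//.
  by apply: contraNneq js => <-.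
rewrite ih// inE; have [->|ij] /= := eqVneq i j; last by case: ifP => // _; exact: sti.
rewrite (negbTE js); apply: enorm_eq0; apply/eqP.
by rewrite eq_le enorm_ge0 andbT -(zT j).
Qed.

Lemma coupled_blocks_meet (x y : V) :
  (forall i, enorm (block A i x - block A i y) <= z i 0) ->
  let st := foldl (coupled_step A F a xi) (x, y) (steps (enum 'I_k)) in
  st.2 = st.1.
Proof.
move=> hxy /=; apply/esym/(block_inj hr hA) => i; apply/eqP.
rewrite -subr_eq0; apply/eqP.
have := coupled_blocks (s := enum 'I_k) (st := (x, y)) (enum_uniq _)
  (fun i _ => hxy i) i.
by rewrite mem_enum.
Qed.

Lemma uniq_steps s : uniq s -> uniq (steps s).
Proof.
move=> us; apply: allpairs_uniq_dep => //; first by move=> i _; exact: iota_uniq.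
pose g (p : 'I_k * nat) := Tagged (fun=> nat) (i := p.1) p.2.
by apply: (can_in_inj (g := g)) => -[i t].
Qed.

End contraction.

(** * Block-wise noisy fine-tuning from two fixed models *)

Section blockwise.
Context {R : realType} {d k : nat} {r : 'I_k -> nat}.
Variable A : forall i : 'I_k, 'M[R]_(d, r i).
Hypothesis hr : (\sum_(i < k) r i)%N = d.
Hypothesis hA : (\mxrow_(i < k) A i)^T *m (\mxrow_(i < k) A i) = 1%:M.
Context {Z : choiceType} {du : measure_display} {Wu : measurableType du}.
Variables (Pu : probability Wu R) (loss : {fset Z} -> 'I_k -> nat -> 'cV[R]_d -> R).
Hypothesis hloss : forall S i t,
  measurable_fun setT (block_grad A i (loss S i t)).
Variables (ft : {fset Z} -> nat -> {mfun 'cV[R]_d >-> 'cV[R]_d}) (m : nat).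
Variables (gamma lambda C1 : R) (T : 'I_k -> nat).
Hypotheses (hgamma : 0 < gamma) (hgl : gamma * lambda < 1) (hC1 : 0 < C1).
Variable xi : forall i : 'I_k, nat -> {RV Pu >-> 'cV[R]_(r i)}.

Definition block_update (S : {fset Z}) i t (W : 'cV[R]_d) : 'cV[R]_(r i) :=
  block A i W - gamma *: (clip C1 (block_grad A i (loss S i t) W) +
                          lambda *: block A i W).

Lemma measurable_block_update S i t : measurable_fun setT (block_update S i t).
Proof.
apply: measurable_cVB; first exact: measurable_block.
apply: measurable_cVZ => //; apply: measurable_cVD; first exact: measurable_clip.
by apply: measurable_cVZ => //; exact: measurable_block.
Qed.

(** Weight decay contracts the gap of the block; two clipped gradients differ by at most [2 * C1],
    wherever they are taken. *)
Lemma block_update_gap S i t X Y :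
  enorm (block_update S i t X - block_update S i t Y) <=
  (1 - gamma * lambda) * enorm (block A i X - block A i Y) + 2 * gamma * C1.
Proof.
set x := block A i X; set y := block A i Y.
set u := clip C1 (block_grad A i (loss S i t) X).
set v := clip C1 (block_grad A i (loss S i t) Y).
have -> : block_update S i t X - block_update S i t Y =
    (1 - gamma * lambda) *: (x - y) - gamma *: (u - v).
  rewrite /block_update -/u -/v -/x -/y; clearbody u v x y.
  by apply/colP => j; rewrite !mxE; ring.
apply: le_trans (ler_enormB _ _) _; rewrite !enormZ !gtr0_norm ?subr_gt0//.
rewrite lerD2l [2 * gamma]mulrC -mulrA ler_pM2l//.
apply: le_trans (ler_enormB _ _) _; rewrite mulr_natl mulr2n.
by apply: lerD; apply: enorm_clip_le; exact: ltW.
Qed.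

(** Setting a block discards its previous value, so writing it back at the end of its fine-tuning or
    after each step gives the same model. *)
Lemma finetune_block_steps S w W i :
  finetune_block A gamma lambda C1 T loss (fun i t => xi i t : Wu -> _) S w W i =
  foldl (block_step A (block_update S) (noise_sample xi w)) W
    [seq (i, t) | t <- iota 0 (T i)].
Proof.
rewrite /finetune_block; elim: (T i) => [|n ih]; first exact: set_block_id.
have iE : iota 0 n.+1 = rcons (iota 0 n) n by rewrite -cats1 -addn1 iotaD.
rewrite iE map_rcons foldl_rcons -ih /= /block_step /= set_block_set_block//.
rewrite /block_update block_set_block//; congr (set_block _ _ (_ + _)).
by apply/colP => j; rewrite mxE.
Qed.

Lemma blockwise_finetuning_steps S w W :
  blockwise_finetuning A gamma lambda C1 T loss (fun i t => xi i t : Wu -> _)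
    (fun S s => ft S s : 'cV[R]_d -> 'cV[R]_d) m S w W =
  foldl (fun V s => ft S s V)
    (foldl (block_step A (block_update S) (noise_sample xi w)) W
       (steps T (enum 'I_k)))
    (iota 0 m).
Proof.
rewrite /blockwise_finetuning; congr foldl.
elim: (enum 'I_k) W => //= i s ih W.
by rewrite ih finetune_block_steps /steps allpairs_cons foldl_cat.
Qed.

Lemma measurable_foldl_ft dT (T' : measurableType dT) (f : T' -> 'cV[R]_d) S l :
  measurable_fun setT f ->
  measurable_fun setT (fun w => foldl (fun V s => ft S s V) (f w) l).
Proof.
by elim: l f => //= s l ih f mf; apply: ih; exact: measurableT_comp.
Qed.

Lemma measurable_blockwise_finetuning dT (T' : measurableType dT) S
    (f : T' -> Wu) (g : T' -> 'cV[R]_d) :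
  measurable_fun setT f -> measurable_fun setT g ->
  measurable_fun setT (fun w =>
    blockwise_finetuning A gamma lambda C1 T loss (fun i t => xi i t : Wu -> _)
      (fun S s => ft S s : 'cV[R]_d -> 'cV[R]_d) m S (f w) (g w)).
Proof.
move=> mf mg; under eq_fun do rewrite blockwise_finetuning_steps.
apply: measurable_foldl_ft; apply: measurable_block_steps => //.
  by move=> i t; exact: measurable_block_update.
exact: (measurableT_comp (measurable_noise_sample xi) mf).
Qed.

(** The run from [x] coincides with the run from [y] on shifted noise, to which the Renyi bound on
    shifts applies. *)
Lemma blockwise_finetuning_close (sigma epsR : 'I_k -> R) (q delta C0 : R)
    S (x y : 'cV[R]_d) (O : set 'cV[R]_d) :
  block_noise Pu sigma xi -> (forall i, 0 < sigma i) -> 1 < q -> 0 < delta ->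
  (forall i, [/\ 0 < C0, 0 < gamma * lambda, (0 < T i)%N &
    q / (2 * sigma i ^+ 2) * shift_energy (1 - gamma * lambda)
      (2 * gamma * C1) (2 * C0) (T i) <= epsR i]) ->
  enorm (x - y) <= 2 * C0 -> measurable O ->
  let law_from z := Pu [set w | O (blockwise_finetuning A gamma lambda C1 T loss
    (fun i t => xi i t : Wu -> _) (fun S s => ft S s : 'cV[R]_d -> 'cV[R]_d) m
    S w z)] in
  (law_from x <= (expR (\sum_(i < k) epsR i + ln delta^-1 / (q - 1)))%:E *
     law_from y + delta%:E)%E.
Proof.
move=> hxi sigma0 q1 delta0 hT xy mO.
have c0 : 0 <= 1 - gamma * lambda by rewrite subr_ge0 ltW.
have b0 : 0 <= 2 * gamma * C1.
  by apply: mulr_ge0; [apply: mulr_ge0 => //; exact: ltW|exact: ltW].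
have schedule i : exists az : (nat -> R) * (nat -> R),
    [/\ az.2 0%N = 2 * C0 /\ az.2 (T i) = 0, forall t, 0 <= az.1 t,
      forall t, (t <= T i)%N -> 0 <= az.2 t,
      forall t, (1 - gamma * lambda) * az.2 t + 2 * gamma * C1 =
        az.2 t.+1 + az.1 t &
      \sum_(t < T i) az.1 t ^+ 2 = shift_energy (1 - gamma * lambda)
        (2 * gamma * C1) (2 * C0) (T i)].
  have [C00 gl0 Ti _] := hT i.
  have c01 : 0 < 1 - gamma * lambda < 1 by rewrite subr_gt0 hgl gtrBl.
  have C02 : 0 <= 2 * C0 by apply: mulr_ge0 => //; exact: ltW.
  have [a [z H]] := shift_schedule c01 b0 C02 Ti.
  by exists (a, z).
have [az Haz] := choice schedule.
pose a i := (az i).1; pose z i := (az i).2.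
have a0 i t : 0 <= a i t by have [_ + _ _ _] := Haz i; exact.
have z0 i t : (t <= T i)%N -> 0 <= z i t by have [_ _ + _ _] := Haz i; exact.
have zS i t : (1 - gamma * lambda) * z i t + 2 * gamma * C1 = z i t.+1 + a i t.
  by have [_ _ _ + _] := Haz i; exact.
have zT i : z i (T i) = 0 by have [[]] := Haz i.
have zx i : enorm (block A i x - block A i y) <= z i 0%N.
  rewrite /z; have [[-> _] _ _ _ _] := Haz i.
  by rewrite -blockB (le_trans _ xy)// enorm_block_le.
pose F := block_update S.
have mF i t : measurable_fun setT (F i t) by exact: measurable_block_update.
pose L := steps T (enum 'I_k).
have uL : uniq L by apply: uniq_steps; exact: enum_uniq.
(* The final fine-tuning is the same map on both sides; as post-processing, it is absorbed into the
   event [OO]. *)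
pose G V := foldl (fun V s => ft S s V) V (iota 0 m).
pose OO := [set v : noise R (@noise_index k r) |
  O (G (foldl (block_step A F v) y L))].
pose s := coupling_shift A F a (x, y) L.
pose E := @noise_coords k r (rev L).
have mG : measurable_fun setT (fun v : noise R (@noise_index k r) =>
    G (foldl (block_step A F v) y L)).
  by apply: measurable_foldl_ft; apply: measurable_block_steps.
have mOO : measurable OO by rewrite -[X in measurable X]setTI; exact: mG.
have ms e : measurable_fun setT (s e) by exact: measurable_coupling_shift.
have ps : predictable s E by exact: predictable_coupling_shift.
(* The energies of the blocks add up before any conversion to [(eps, delta)], which is why
   [ln delta^-1 / (q - 1)] occurs once in the total and not once per block. *)
have sB v : \sum_(e <- E) q * s e v ^+ 2 / (2 * sigma (tag e) ^+ 2) <=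
    \sum_(i < k) epsR i.
  have q0 i : 0 <= q / (2 * sigma i ^+ 2).
    apply: divr_ge0; first lra.
    by apply: mulr_ge0 => //; exact: sqr_ge0.
  under eq_bigr do rewrite mulrAC.
  apply: le_trans (energy_coupling_shift A F (x, y) L v q0 a0) _.
  rewrite /L /steps big_allpairs_dep big_enum/=; apply: ler_sum => i _.
  have [_ _ _ _ Ei] := Haz i; have [_ _ _] := hT i; rewrite -Ei => Hi.
  by rewrite -mulr_sumr -[X in iota 0 X]subn0 -/(index_iota _ _) big_mkord.
pose BF w V := blockwise_finetuning A gamma lambda C1 T loss
  (fun i t => xi i t : Wu -> _) (fun S s => ft S s : 'cV[R]_d -> 'cV[R]_d) m
  S w V.
have H := renyi_shift_noise_sample hxi sigma0 ms ps q1 delta0 sB mOO.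
have Ey : [set w | O (BF w y)] = [set w | OO (noise_sample xi w)].
  by apply/seteqP; split=> w; rewrite /OO /= /BF blockwise_finetuning_steps.
have Ex : [set w | O (BF w x)] =
    [set w | OO (shift_noise s E (noise_sample xi w))].
  have meet w : foldl (block_step A F (noise_sample xi w)) x L =
      foldl (block_step A F (shift_noise s E (noise_sample xi w))) y L.
    rewrite (shifted_block_steps A F a (x, y) uL).
    rewrite (coupled_blocks_meet hr hA c0 (block_update_gap S) a0 z0 zS zT _ zx).
    by rewrite coupled_step_fst.
  by apply/seteqP; split=> w;
    rewrite /OO /= /BF blockwise_finetuning_steps -/F -/L meet.
by rewrite -Ex -Ey in H.
Qed.

End blockwise.

(** * Integration over the training randomness *)

Section product_laws.
Context {R : realType} {d1 d2 : measure_display}.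
Context {T1 : measurableType d1} {T2 : measurableType d2}.
Variables (P1 : probability T1 R) (P2 : probability T2 R).
Local Notation PP := (P1 \x P2)%E.

(** Integration of the sectionwise bound over the first variable. The set [E] lets [delta] be scaled
    by the mass of a conditioning event. *)
Lemma product_measure_close (e delta : R) (A B E : set (T1 * T2)) :
  0 <= e -> 0 <= delta -> measurable A -> measurable B -> measurable E ->
  (forall w, (P2 (xsection A w) <=
    e%:E * P2 (xsection B w) + delta%:E * P2 (xsection E w))%E) ->
  fine (PP A) <= e * fine (PP B) + delta * fine (PP E).
Proof.
move=> e0 delta0 mA mB mE AB.
have mx (C : set (T1 * T2)) : measurable C ->
    measurable_fun setT (fun w => P2 (xsection C w)).
  by move=> mC; exact: measurable_fun_xsection.
have : (PP A <= e%:E * PP B + delta%:E * PP E)%E.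
  rewrite /product_measure1 -!ge0_integralZl ?lee_fin//; try exact: mx.
  rewrite -ge0_integralD//; first last.
  - by apply: measurable_funeM; exact: mx.
  - by move=> w _; rewrite mule_ge0 ?lee_fin.
  - by apply: measurable_funeM; exact: mx.
  - by move=> w _; rewrite mule_ge0 ?lee_fin.
  apply: ge0_le_integral => //=; first exact: mx.
  by apply: emeasurable_funD; apply: measurable_funeM; exact: mx.
have fP (C : set (T1 * T2)) : measurable C -> PP C \is a fin_num.
  pose P12 : probability (T1 * T2)%type R := (P1 \x P2)%E.
  by move=> mC; exact: (fin_num_measure P12 C mC).
rewrite -{1}(fineK (fP _ mA)) -{1}(fineK (fP _ mB)) -{1}(fineK (fP _ mE)).
by rewrite -!EFinM -EFinD lee_fin.
Qed.

Section laws.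
Variables (V : Type) (e delta : R) (X Y : T1 * T2 -> V) (C : set T1) (O : set V).
Hypotheses (e0 : 0 <= e) (delta0 : 0 <= delta) (mC : measurable C).
Hypotheses (mX : measurable (X @^-1` O)) (mY : measurable (Y @^-1` O)).

Lemma joint_law_close :
  (forall w, C w -> (P2 [set u | O (X (w, u))] <=
    e%:E * P2 [set u | O (Y (w, u))] + delta%:E)%E) ->
  fine (PP (X @^-1` O `&` fst @^-1` C)) <=
  e * fine (PP (Y @^-1` O `&` fst @^-1` C)) + delta * fine (PP (fst @^-1` C)).
Proof.
move=> XY.
have mC' : measurable (fst @^-1` C : set (T1 * T2)).
  by rewrite -[X in measurable X]setTI; exact: measurable_fst.
apply: product_measure_close => //; try exact: measurableI.
move=> w; have [Cw|nCw] := pselect (C w).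
  have E (X' : T1 * T2 -> V) : xsection (X' @^-1` O `&` fst @^-1` C) w =
      [set u | O (X' (w, u))].
    apply/seteqP; split=> u; rewrite /xsection/= inE/=; first by case.
    by split.
  have -> : xsection (fst @^-1` C) w = [set: T2].
    by apply/seteqP; split=> // u _; rewrite /xsection/= inE.
  by rewrite !E probability_setT mule1; exact: XY.
have E (D : set (T1 * T2)) : xsection (D `&` fst @^-1` C) w = set0.
  by apply/seteqP; split=> u //; rewrite /xsection/= inE/= => -[].
rewrite !E !measure0 mule0 add0e mule_ge0//.
Qed.

Lemma law_given_close :
  (forall w, C w -> (P2 [set u | O (X (w, u))] <=
    e%:E * P2 [set u | O (Y (w, u))] + delta%:E)%E) ->
  law_given PP (fst @^-1` C) X O <= e * law_given PP (fst @^-1` C) Y O + delta.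
Proof.
move=> /joint_law_close; rewrite /law_given /=.
set a := fine (PP (X @^-1` O `&` _)); set b := fine (PP (Y @^-1` O `&` _)).
set p := fine (PP _) => H.
(* On a negligible event the quotients are 0 by convention, and [0 <= delta] is left. *)
have [->|p0] := eqVneq p 0; first by rewrite invr0 !mulr0 add0r.
have pp : 0 < p by rewrite lt_neqAle eq_sym p0 fine_ge0.
by rewrite ler_pdivrMr// mulrDl -!mulrA mulVf// mulr1.
Qed.

End laws.

Lemma law_close (V : Type) (e delta : R) (X Y : T1 * T2 -> V) (O : set V) :
  0 <= e -> 0 <= delta ->
  measurable (X @^-1` O) -> measurable (Y @^-1` O) ->
  (forall w, (P2 [set u | O (X (w, u))] <=
    e%:E * P2 [set u | O (Y (w, u))] + delta%:E)%E) ->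
  law PP X O <= e * law PP Y O + delta.
Proof.
move=> e0 delta0 mX mY XY.
have := joint_law_close e0 delta0 measurableT mX mY (fun w _ => XY w).
rewrite preimage_setT !setIT.
suff -> : PP setT = 1%E by rewrite mulr1.
exact: (probability_setT (P1 \x P2 : probability (T1 * T2)%type R)%E).
Qed.

End product_laws.

(** * Unlearning guarantees under proximity and under clipping *)

Theorem theorem4p2 (R : realType) :
  exists Tmin : R -> R -> R -> R -> R -> R -> R -> nat,
  forall
    (d k : nat) (r : 'I_k -> nat) (A : forall i : 'I_k, 'M[R]_(d, r i))
    (hr : (\sum_(i < k) r i)%N = d)
    (hA : (\mxrow_(i < k) A i)^T *m (\mxrow_(i < k) A i) = 1%:M)
    (Z : choiceType) (D : {fset Z})
    (da du : measure_display) (Wa : measurableType da) (Wu : measurableType du)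
    (Pa : probability Wa R) (Pu : probability Wu R)
    (alg : {fset Z} -> {RV Pa >-> 'cV[R]_d})
    (loss : {fset Z} -> 'I_k -> nat -> 'cV[R]_d -> R)
    (hloss : forall S i t, measurable_fun setT (block_grad A i (loss S i t)))
    (ft : {fset Z} -> nat -> {mfun 'cV[R]_d >-> 'cV[R]_d}) (m : nat)
    (gamma lambda C1 q delta : R) (eps epsR sigma : 'I_k -> R) (T : 'I_k -> nat)
    (hgamma : 0 < gamma) (hlambda : 0 <= lambda) (hgl : gamma * lambda < 1)
    (hC1 : 0 < C1) (hq : 1 < q) (hdelta : 0 < delta)
    (hepsR : forall i, 0 < epsR i)
    (heps : forall i, eps i = epsR i + ln (delta^-1) / (q - 1))
    (hsigma : forall i, 0 < sigma i)
    (xi : forall i : 'I_k, nat -> {RV Pu >-> 'cV[R]_(r i)})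
    (hxi : block_noise Pu sigma xi),
    let total := \sum_(i < k) epsR i + ln (delta^-1) / (q - 1) in
    (forall (rho Delta : R), 0 < rho <= 1 ->
       (forall i, calibrated Tmin gamma lambda (Delta / 2) C1 q (epsR i)
                    (sigma i) (T i)) ->
       unlearning_under_proximity alg (Pu := Pu)
         (blockwise_unlearning A gamma lambda C1 T loss xi ft m)
         rho Delta D total delta)
    /\
    (forall C0 : R, 0 < C0 ->
       (forall i, calibrated Tmin gamma lambda C0 C1 q (epsR i)
                    (sigma i) (T i)) ->
       unlearning alg (Pu := Pu)
         (clipped_blockwise_unlearning A gamma lambda C1 T loss xi ft m C0)
         D total delta).
Proof.
have [Tmin hTmin] := @calibration_steps R; exists Tmin.
move=> d k r A hr hA Z D da du Wa Wu Pa Pu alg loss hloss ft m.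
move=> gamma lambda C1 q delta eps epsR sigma T hgamma hlambda hgl hC1 hq hdelta.
move=> hepsR _ hsigma xi hxi total.
pose BF S w V := blockwise_finetuning A gamma lambda C1 T loss
  (fun i t => xi i t : Wu -> _) (fun S s => ft S s : 'cV[R]_d -> 'cV[R]_d) m
  S w V.
(* Both formulations come down to this bound, [C0] being half the distance allowed between the
   starting models. *)
have close C0 S x y O :
    (forall i, calibrated Tmin gamma lambda C0 C1 q (epsR i) (sigma i) (T i)) ->
    enorm (x - y) <= 2 * C0 -> measurable O ->
    (Pu [set u | O (BF S u x)] <=
      (expR total)%:E * Pu [set u | O (BF S u y)] + delta%:E)%E.
  move=> hcal xy mO.
  have hT i := hTmin _ _ _ _ _ _ _ _ hgamma hlambda hgl hC1 hq (hepsR i)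
    (hsigma i) (hcal i).
  exact: (blockwise_finetuning_close hr hA hloss ft m hgamma hgl hC1 S
    hxi hsigma hq hdelta hT xy mO).
have mBF S (pre : 'cV[R]_d -> 'cV[R]_d) S' : measurable_fun setT pre ->
    measurable_fun setT (fun w : Wa * Wu => BF S w.2 (pre (alg S' w.1))).
  move=> mpre; apply: measurable_blockwise_finetuning => //.
  apply: (measurableT_comp mpre).
  exact: (measurableT_comp _ measurable_fst).
have expR0' : 0 <= expR total by exact: expR_ge0.
have delta0 : 0 <= delta by exact: ltW.
have mBFO S (pre : 'cV[R]_d -> 'cV[R]_d) S' O : measurable_fun setT pre ->
    measurable O ->
    measurable ((fun w : Wa * Wu => BF S w.2 (pre (alg S' w.1))) @^-1` O).
  by move=> mpre mO; rewrite -[X in measurable X]setTI; exact: (mBF S _ S').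
(* A certifying algorithm must be a random variable on the product space, hence the bundling of its
   measurability. *)
have certified (pre : 'cV[R]_d -> 'cV[R]_d) : measurable_fun setT pre ->
    exists Abar : {fset Z} -> {RV (Pa \x Pu)%E >-> 'cV[R]_d},
    forall S, Abar S = (fun w : Wa * Wu => BF S w.2 (pre (alg S w.1))) :> (_ -> _).
  move=> mpre; pose mU S := isMeasurableFun.Build _ _ _ _ _ (mBF S pre S mpre).
  pose Abar S : {RV (Pa \x Pu)%E >-> 'cV[R]_d} :=
    HB.pack (fun w : Wa * Wu => BF S w.2 (pre (alg S w.1))) (mU S).
  by exists Abar.
split.
- move=> rho Delta _ hcal.
  have [Abar AbarE] := certified id (@measurable_id _ _ setT).
  exists Abar.
    (* With an empty forget set the mechanism fine-tunes on [S] itself, so the certifying run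
       differs from the unlearning one by its starting model only. *)
    by move=> S w; rewrite AbarE /unlearned /blockwise_unlearning fsetD0.
  move=> Df _ _ O mO; set Dr := (D `\` Df)%fset; rewrite AbarE.
  (* The proximity event concerns the training sample alone, so it is a cylinder over [Wa]. *)
  pose C := [set w : Wa | enorm (alg D w - alg Dr w) <= Delta].
  have mC : measurable C.
    have mnorm : measurable_fun setT (fun w : Wa => enorm (alg D w - alg Dr w)).
      by apply: measurable_enorm; exact: measurable_cVB.
    have -> : C = (fun w => enorm (alg D w - alg Dr w)) @^-1` `]-oo, Delta].
      by apply/seteqP; split=> w; rewrite /C /= in_itv.
    by rewrite -[X in measurable X]setTI; exact: mnorm.
  have Delta2 : 2 * (Delta / 2) = Delta by field.
  have mX S := mBFO Dr id S O (@measurable_id _ _ setT) mO.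
  have gap S S' : (forall w, C w -> enorm (alg S w - alg S' w) <= Delta) ->
      law_given (Pa \x Pu)%E (fst @^-1` C)
        (fun w : Wa * Wu => BF Dr w.2 (alg S w.1)) O <=
      expR total * law_given (Pa \x Pu)%E (fst @^-1` C)
        (fun w : Wa * Wu => BF Dr w.2 (alg S' w.1)) O + delta.
    move=> SS'; apply: (law_given_close Pa expR0' delta0 mC (mX S) (mX S')) => w Cw.
    apply: (close _ Dr (alg S w) (alg S' w) O hcal _ mO).
    by rewrite Delta2; exact: SS'.
  split; first exact: (gap D Dr).
  by apply: (gap Dr D) => w Cw; rewrite -opprB enormN.
- move=> C0 C00 hcal.
  have mclip : measurable_fun setT (@clip R d C0).
    by apply: measurable_clip; exact: measurable_id.
  have [Abar AbarE] := certified _ mclip.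
  exists Abar.
    move=> S w; rewrite AbarE /unlearned /clipped_blockwise_unlearning.
    by rewrite /blockwise_unlearning fsetD0.
  move=> Df _ O mO; set Dr := (D `\` Df)%fset; rewrite AbarE.
  (* Clipping alone bounds the distance of the starting models, for every training sample, so no
     conditioning occurs here. *)
  have gap u v : enorm (clip C0 u - clip C0 v) <= 2 * C0 :> R.
    apply: le_trans (ler_enormB _ _) _; rewrite mulr_natl mulr2n.
    by apply: lerD; apply: enorm_clip_le; exact: ltW.
  have mX S := mBFO Dr _ S O mclip mO.
  have lawC S S' : law (Pa \x Pu)%E
        (fun w : Wa * Wu => BF Dr w.2 (clip C0 (alg S w.1))) O <=
      expR total * law (Pa \x Pu)%E
        (fun w : Wa * Wu => BF Dr w.2 (clip C0 (alg S' w.1))) O + delta.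
    apply: (law_close Pa expR0' delta0 (mX S) (mX S')) => w.
    have := close _ Dr (clip C0 (alg S w)) (clip C0 (alg S' w)) O hcal.
    by apply => //; exact: gap.
  by split; [exact: (lawC D Dr)|exact: (lawC Dr D)].
Qed.
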